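(* Let $(\Omega_0,\Sigma_0)$ be a standard Borel space and let $\xi\equiv(\xi_n)_{n\in\mathbb{N}_0}$ be a sequence of $(\Omega_0,\Sigma_0)$-valued random variables on the standard probability space $(\Omega,\Sigma,\mu)$. If $\xi$ is a stationary Markov sequence, then its function sequence $\zeta\equiv(\zeta_n:=f\circ\xi_n)_{n=0}^\infty$ is partially spreadable for any measurable function $f\colon(\Omega_0,\Sigma_0)\to(\Omega_0,\Sigma_0)$.
   Context: All $\sigma$-subalgebras are completed with respect to $\mu$-null sets. For $I\subset\mathbb{N}_0$, $\Sigma^\xi_I$ is the $\sigma$-subalgebra of $\Sigma$ generated by $\{\xi_i:i\in I\}$; $\sigma\{\xi_n\}:=\Sigma^\xi_{\{n\}}$. For a $\sigma$-subalgebra $\tilde\Sigma$, $\mathbb{E}_{\tilde\Sigma}$ is the $\mu$-preserving conditional expectation from $L^\infty(\Omega,\Sigma,\mu)$ onto $L^\infty(\Omega,\tilde\Sigma,\mu|_{\tilde\Sigma})$. Stationary: $(\xi_0,\xi_1,\dots)$ and $(\xi_n,\xi_{n+1},\dots)$ have the same distribution for all $n\ge1$. Markov sequence: $\mathbb{E}_{\Sigma^\xi_{[0,n]}}\mathbb{E}_{\sigma\{\xi_{n+1}\}}=\mathbb{E}_{\sigma\{\xi_n\}}\mathbb{E}_{\sigma\{\xi_{n+1}\}}$ for all $n\ge 0$, with $[0,n]=\{0,\dots,n\}$. A sequence $\xi$ on a standard probability space $(\Omega,\Sigma,\mu)$ is partially spreadable if there exist $\Sigma$-measurable $\mu$-preserving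 maps $\{\eta_n\}_{n\ge 0}$ on $\Omega$ satisfying $\eta_\ell\circ\eta_k=\eta_k\circ\eta_{\ell+1}$ for all $0\le k<\ell<\infty$ (so that the operators $\alpha_n(f):=f\circ\eta_n$ satisfy $\alpha_k\alpha_\ell=\alpha_{\ell+1}\alpha_k$ for $k<\ell$, the relations of the Thompson monoid $F^+$), such that $\xi_0=\xi_0\circ\eta_k$ for all $k>0$ and $\xi_n=\xi_0\circ\eta_0^n$ for all $n\ge 0$. More generally, a sequence of $(\Omega_0,\Sigma_0)$-valued random variables on a probability space is called partially spreadable if it has the same distribution as such a sequence (possibly on another standard probability space). *)

(* Defs.v *)
From HB Require Import structures.
From mathcomp Require Import all_boot all_order all_algebra.
From mathcomp Require Import all_classical all_reals all_analysis.

Set Implicit Arguments.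
Unset Strict Implicit.
Unset Printing Implicit Defensive.

Import Order.TTheory GRing.Theory Num.Theory.
Import numFieldNormedType.Exports.

Local Open Scope classical_set_scope.
Local Open Scope ring_scope.

(* The bijection phi transports the Borel sets of a complete separable metric
   space X to T, i.e. the sigma-algebra of T is the Borel sigma-algebra of a
   Polish topology. *)
Definition standard_borel (R : realType) d (T : measurableType d) : Prop :=
  exists (X : metricType R) (phi : T -> X),
    [/\ forall F : set_system X, ProperFilter F -> cauchy F -> exists x : X, F --> x,
        exists2 D : set X, countable D & dense D,
        bijective phi
      & @measurable d T =
        preimage_set_system setT phi <<s [set U : set X | open U] >>].

(* A standard probability space is (T, mu) with standard_borel R T and
   mu : probability T R.  Sigma-subalgebras are families G : set_system T. *)

Section sequences_of_random_variables.
Context d (T : measurableType d) d0 (T0 : measurableType d0) (R : realType).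
Variable mu : probability T R.

(* Null sets are taken inside the sigma-algebra of T, so that the result is
   again a sigma-subalgebra. *)
Definition sigma_rv (xi : nat -> {RV mu >-> T0}) (I : set nat) : set_system T :=
  <<s (\bigcup_(i in I) preimage_set_system setT (xi i) measurable) `|`
      [set N | measurable N /\ mu N = 0%E] >>.

(* g is a version of the conditional expectation of f given G, as a map from
   L^oo(T, mu) to L^oo(T, G, mu). *)
Definition is_cond_exp (G : set_system T) (f g : T -> R) : Prop :=
  [/\ g \in Lfun mu +oo,
      forall B : set R, measurable B -> G (g @^-1` B)
    & forall A, G A ->
        (\int[mu]_(x in A) (g x)%:E = \int[mu]_(x in A) (f x)%:E)%E].

(* Versions are unique only up to null sets: cond_exp picks one (the default
   value 0 is irrelevant, since every f in L^oo has a version) and its values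
   are only meant to be compared with %[ae mu]. *)
Definition cond_exp (G : set_system T) (f : T -> R) : T -> R :=
  xget (cst 0) [set g | is_cond_exp G f g].

Definition markov_sequence (xi : nat -> {RV mu >-> T0}) : Prop :=
  forall (n : nat) (f : T -> R), f \in Lfun mu +oo ->
    cond_exp (sigma_rv xi [set i | (i <= n)%N])
             (cond_exp (sigma_rv xi [set n.+1]) f) =
    cond_exp (sigma_rv xi [set n])
             (cond_exp (sigma_rv xi [set n.+1]) f) %[ae mu].

End sequences_of_random_variables.

(* The product sigma-algebra on sequences. *)
Definition cylinder_sigma d0 (T0 : measurableType d0) : set_system (nat -> T0) :=
  <<s \bigcup_n preimage_set_system setT (fun w : nat -> T0 => w n) measurable >>.

(* Equality of the two laws on the path space nat -> T0. *)
Definition same_distribution (R : realType) d0 (T0 : measurableType d0)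
    d1 (T1 : measurableType d1) (mu1 : probability T1 R)
    d2 (T2 : measurableType d2) (mu2 : probability T2 R)
    (xi1 : nat -> {RV mu1 >-> T0}) (xi2 : nat -> {RV mu2 >-> T0}) : Prop :=
  forall A : set (nat -> T0), cylinder_sigma A ->
    mu1 ((fun x n => xi1 n x) @^-1` A) = mu2 ((fun x n => xi2 n x) @^-1` A).

Definition stationary_sequence (R : realType) d (T : measurableType d)
    d0 (T0 : measurableType d0) (mu : probability T R)
    (xi : nat -> {RV mu >-> T0}) : Prop :=
  forall n : nat, (1 <= n)%N -> same_distribution xi (fun k => xi (n + k)%N).

Definition measure_preserving (R : realType) d (T : measurableType d)
    (mu : probability T R) (eta : {mfun T >-> T}) : Prop :=
  forall A : set T, measurable A -> mu (eta @^-1` A) = mu A.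

(* Partial spreadability witnessed by maps on the space (T, mu) itself; the
   identities between maps hold at every point. *)
Definition spreading_maps (R : realType) d (T : measurableType d)
    d0 (T0 : measurableType d0) (mu : probability T R)
    (xi : nat -> {RV mu >-> T0}) (eta : nat -> {mfun T >-> T}) : Prop :=
  [/\ forall n, measure_preserving mu (eta n),
      forall k l, (k < l)%N -> eta l \o eta k = eta k \o eta l.+1,
      forall k, (0 < k)%N -> xi 0%N = xi 0%N \o eta k :> (T -> T0)
    & forall n, xi n = xi 0%N \o iter n (eta 0%N) :> (T -> T0)].

Definition partially_spreadable (R : realType) d (T : measurableType d)
    d0 (T0 : measurableType d0) (mu : probability T R)
    (xi : nat -> {RV mu >-> T0}) : Prop :=
  exists (d' : measure_display) (T' : measurableType d')
    (mu' : probability T' R) (xi' : nat -> {RV mu' >-> T0})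
    (eta : nat -> {mfun T' >-> T'}),
    [/\ standard_borel R T', same_distribution xi xi'
      & spreading_maps xi' eta].

(* Main.v *)
Require Import Defs.
From HB Require Import structures.
From mathcomp Require Import all_boot all_order all_algebra.
From mathcomp Require Import all_classical all_reals all_analysis.
From mathcomp Require Import measurable_realfun ess_sup_inf lra.

(* The state space is a measurable retract of Cantor space C = {0,1}^N, so the
   chain may be taken to be C-valued.  Writing U for a sequence of fair coin
   tosses, the transition kernel has the form "law of g(y, U)" for some
   measurable g : C * C -> C.  The dilation lives on C * C, with the stationary
   law on the state y and coin tosses on the noise c; c is read as an infinite
   array of independent rows.  The Markov shift
     eta_0 (y, c) = (g (y, row 0 of c), c without row 0)
   produces the chain, and eta_k (y, c) = (y, c without row k) for k > 0 leaves
   the state alone.  Deleting row k and then row l is the same as deleting row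
   l+1 and then row k, whenever k <= l, and this is the relation of the Thompson
   monoid.  A function of the state is again a function of the first
   coordinate, so it costs nothing to replace the chain by its image under f. *)

Set Implicit Arguments.
Unset Strict Implicit.
Unset Printing Implicit Defensive.

Import Order.TTheory GRing.Theory Num.Theory.

Local Open Scope classical_set_scope.
Local Open Scope ring_scope.

(** * Sequence spaces *)

(** The identities between the maps are demanded at every point, so they must not depend on choices
    made up to null sets; for deletion of rows they are identities of indices. Null sets occur only
    in building [g] and in reading the Markov property. For each finite word [s] a Radon-Nikodym
    derivative gives the conditional probability that the next state begins with [s]; the additivity
    relations between these hold off a single null set because there are only countably many words.
    This is what coding the states in Cantor space buys. Cutting [0,1) according to these
    probabilities turns a uniform number into a sample of the next state, and binary expansion turns
    coin tosses into a uniform number. One [g] serves all times because stationarity fixes the law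
    of each pair of neighbouring states. The induction on time rests on one fact: the shift consumes
    row 0, so the noise that remains is still fair and independent of the past. The Markov property,
    given by conditional expectations on completed sigma-algebras, is first turned into an identity
    of integrals over past events. *)

Section restricted_law.
Context d (T : measurableType d) d' (T' : measurableType d') (R : realType).
Variables (mu : {finite_measure set T -> \bar R}) (D : set T).
Variables (mD : measurable D) (f : {mfun T >-> T'}).

(** With [D] frozen, the mass of a joint event is a finite measure in the other event, so identities
    between joint laws can be proved one variable at a time by uniqueness of measures. *)
Definition restricted_law : set T' -> \bar R := pushforward (mrestr mu mD) f.

Lemma restricted_lawE A : restricted_law A = mu (D `&` f @^-1` A).
Proof. by rewrite /restricted_law /pushforward /mrestr setIC. Qed.

Let rlaw0 : restricted_law set0 = 0%E.
Proof. exact: measure0. Qed.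

Let rlaw_ge0 A : (0 <= restricted_law A)%E.
Proof. exact: measure_ge0. Qed.

Let rlaw_sigma_additive : semi_sigma_additive restricted_law.
Proof. exact: measure_semi_sigma_additive. Qed.

HB.instance Definition _ :=
  isMeasure.Build _ _ _ restricted_law rlaw0 rlaw_ge0 rlaw_sigma_additive.

Let rlaw_fin : fin_num_fun restricted_law.
Proof.
move=> A mA; rewrite restricted_lawE; apply: fin_num_measure.
by apply: measurableI => //; exact: measurable_funPTI.
Qed.

HB.instance Definition _ := Measure_isFinite.Build _ _ _ restricted_law rlaw_fin.

End restricted_law.

(** The generating family is that of [cylinder_sigma], so a measurable set of this type is literally
    a member of [cylinder_sigma]. *)
Definition seqspace d0 (T0 : measurableType d0) :=
  g_sigma_algebraType
    (\bigcup_n preimage_set_system setT (fun w : nat -> T0 => w n) measurable).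

HB.instance Definition _ d0 (T0 : measurableType d0) :=
  Measurable.on (seqspace T0).

Notation cantor := (seqspace bool).

Section seqspace_theory.
Context d0 (T0 : measurableType d0).

Lemma measurable_coord n : measurable_fun setT (fun w : seqspace T0 => w n).
Proof.
move=> _ A mA; apply: sub_sigma_algebra; exists n => //; exists A => //.
Qed.

Lemma measurable_to_seqspace d (T : measurableType d) (f : T -> seqspace T0) :
  (forall n, measurable_fun setT (fun x => f x n)) -> measurable_fun setT f.
Proof.
move=> mf; apply: (@measurability _ _ _ (seqspace T0) setT f _ (erefl _)).
move=> _ [_ [n _ [A mA <-]] <-].
by rewrite !setTI; have := mf n measurableT A mA; rewrite setTI.
Qed.

Lemma measurable_cylinder n (A : nat -> set T0) :
  (forall i, measurable (A i)) ->
  measurable [set w : seqspace T0 | forall i, (i < n)%N -> A i (w i)].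
Proof.
move=> mA.
rewrite (_ : [set _ | _] = \bigcap_(i in [set i | (i < n)%N])
    ((fun w : seqspace T0 => w i) @^-1` A i)); last first.
  by apply/seteqP; split => w h i il; exact: h.
apply: bigcap_measurableType.
by move=> i _; rewrite -[X in measurable X]setTI; exact: measurable_coord.
Qed.

Lemma seqspace_measure_unique (R : realType)
    (m1 m2 : {finite_measure set (seqspace T0) -> \bar R}) :
  (forall n (A : nat -> set T0), (forall i, measurable (A i)) ->
    m1 [set w | forall i, (i < n)%N -> A i (w i)] =
    m2 [set w | forall i, (i < n)%N -> A i (w i)]) ->
  forall A, measurable A -> m1 A = m2 A.
Proof.
move=> m12 A mA.
pose G : set_system (seqspace T0) := [set B | exists n (A : nat -> set T0),
  (forall i, measurable (A i)) /\
  B = [set w | forall i, (i < n)%N -> A i (w i)]].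
have GT : G setT.
  by exists 0%N, (fun=> setT); split => //; apply/seteqP; split.
apply: (measure_unique G (fun=> setT)) => //.
- apply/seteqP; split.
    apply: smallest_sub; first exact: smallest_sigma_algebra.
    move=> _ [n _ [B mB <-]]; apply: sub_sigma_algebra.
    exists n.+1, (fun i => if i == n then B else setT); split.
      by move=> i; case: ifP.
    rewrite setTI; apply/seteqP; split => [w /= Bw i|w /= /(_ n)].
      by case: eqP => [->|].
    by rewrite eqxx; apply.
  apply: smallest_sub; first exact: sigma_algebra_measurable.
  by move=> _ [n [B [mB ->]]]; exact: measurable_cylinder.
- move=> _ _ [n [B [mB ->]]] [m [C [mC ->]]].
  exists (maxn n m), (fun i => (if (i < n)%N then B i else setT) `&`
                      (if (i < m)%N then C i else setT)); split.
    by move=> i; apply: measurableI; case: ifP.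
  apply/seteqP; split => w /=.
    by move=> [Bw Cw] i _; split; case: ifP => //; [exact: Bw|exact: Cw].
  move=> h; split => i il.
    by have := h i; rewrite leq_max il /= => /(_ isT)[].
  by have := h i; rewrite leq_max il orbT => /(_ isT)[]; case: ifP.
- by rewrite bigcup_const.
- by move=> _ [n [B [mB ->]]]; exact: m12.
- by move=> _; rewrite -ge0_fin_numE; [exact: fin_num_measure|exact: measure_ge0].
Qed.

End seqspace_theory.

(** * Prefix sets in Cantor space *)

Section cantor_theory.

Definition prefix_set (s : seq bool) : set cantor := [set w | mkseq w (size s) = s].

Lemma prefix_setE s :
  prefix_set s = [set w | forall i, (i < size s)%N -> w i = nth false s i].
Proof.
apply/seteqP; split => w /=.
  by move=> <- i; rewrite size_mkseq => il; rewrite nth_mkseq.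
move=> h; apply: (@eq_from_nth _ false); rewrite size_mkseq// => i il.
by rewrite nth_mkseq// h.
Qed.

Lemma measurable_prefix_set s : measurable (prefix_set s).
Proof.
rewrite prefix_setE.
exact: (@measurable_cylinder _ _ _ (fun i => [set nth false s i])).
Qed.

Lemma prefix_setT : prefix_set [::] = setT.
Proof. by apply/seteqP; split. Qed.

Lemma mem_prefix_set n (w : cantor) : prefix_set (mkseq w n) w.
Proof. by rewrite /prefix_set /= size_mkseq. Qed.

(** Two words either are comparable or already differ, so prefix sets together with the empty set
    form a pi-system. *)
Lemma prefix_setI s t : (size s <= size t)%N ->
  prefix_set s `&` prefix_set t = set0 \/ prefix_set s `&` prefix_set t = prefix_set t.
Proof.
move=> st; have [ts|ts] := eqVneq (take (size s) t) s; [right|left].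
  apply/seteqP; split => [w []//|w wt]; split => //.
  move: wt; rewrite /prefix_set /= => wt.
  by rewrite -{2}ts -wt /mkseq -map_take take_iota (minn_idPl st).
apply/seteqP; split => // w []; rewrite /prefix_set /= => ws wt.
move/eqP: ts; apply.
by rewrite -[in RHS]ws -wt /mkseq -map_take take_iota (minn_idPl _)//.
Qed.

Lemma cantor_measure_unique (R : realType)
    (m1 m2 : {finite_measure set cantor -> \bar R}) :
  (forall s, m1 (prefix_set s) = m2 (prefix_set s)) ->
  forall A, measurable A -> m1 A = m2 A.
Proof.
move=> m12 A mA.
pose G : set_system cantor := [set B | B = set0 \/ exists s, B = prefix_set s].
apply: (measure_unique G (fun=> setT)) => //.
- apply/seteqP; split.
    apply: smallest_sub; first exact: smallest_sigma_algebra.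
    move=> _ [n _ [B mB <-]].
    (* A condition on bit [n] is a countable union over the words of length [n.+1], hence generated
       by prefix sets. *)
    pose S := [set s : seq bool | size s = n.+1 /\ B (nth false s n)].
    rewrite (_ : _ `&` _ = \bigcup_s
       (if pselect (S s) then prefix_set s else set0)); last first.
      rewrite setTI; apply/seteqP; split => [w /= Bw|w [s _]].
        exists (mkseq w n.+1) => //; case: pselect => [?|[]].
          exact: mem_prefix_set.
        by split; rewrite ?size_mkseq// nth_mkseq.
      case: pselect => // -[ss Bs]; rewrite prefix_setE /= => /(_ n).
      by rewrite ss => ->.
    apply: (@countable_bigcupT_measurable _ (g_sigma_algebraType G)).
      exact: countableP.
    move=> s.
    apply: sub_sigma_algebra; case: pselect => /= ?; last by left.
    by right; exists s.
  apply: smallest_sub; first exact: sigma_algebra_measurable.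
  move=> _ [->|[s ->]]; first exact: measurable0.
  exact: measurable_prefix_set.
- move=> _ _ [->|[s ->]] [->|[t ->]]; rewrite ?set0I ?setI0; try by left.
  have [st|/ltnW ts] := leqP (size s) (size t).
    by have [->|->] := prefix_setI st; [left|right; exists t].
  by rewrite setIC; have [->|->] := prefix_setI ts; [left|right; exists s].
- by move=> _; right; exists [::]; rewrite prefix_setT.
- by rewrite bigcup_const.
- by move=> _ [->|[s ->]]; [rewrite !measure0|exact: m12].
- by move=> _; rewrite -ge0_fin_numE; [exact: fin_num_measure|exact: measure_ge0].
Qed.

End cantor_theory.

(** * Cantor space is standard Borel *)

Lemma exists_half_expr (R : archiRealFieldType) (e : R) :
  0 < e -> exists n, 2^-1 ^+ n < e.
Proof.
move=> e0; exists (Num.bound e^-1).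
rewrite exprVn invf_plt ?posrE ?exprn_gt0//.
by apply: upper_nthrootP.
Qed.

Lemma half_exprP (R : realFieldType) m n :
  ((2^-1 : R) ^+ m <= 2^-1 ^+ n) = (n <= m)%N.
Proof.
by rewrite ler_iXn2l ?invr_gt0// invf_lt1// ltr1n.
Qed.

Definition cantor_metric (R : realType) := nat -> bool.

Section cantor_metric.
Variable R : realType.
Implicit Types a b c : cantor_metric R.

Let cdist a b : R :=
  if pselect (exists n, a n != b n) is left h then 2^-1 ^+ ex_minn h else 0.

Let cdist_le a b n : cdist a b <= 2^-1 ^+ n <-> forall i, (i < n)%N -> a i = b i.
Proof.
rewrite /cdist; case: pselect => [h|nh]; last first.
  split => _; last by rewrite exprn_ge0// invr_ge0.
  by move=> i _; apply/eqP/negP => /negP ab; apply: nh; exists i.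
rewrite half_exprP; case: ex_minnP => k abk kmin; split.
  move=> nk i ik; apply/eqP/negP => /negP /kmin; rewrite leqNgt.
  by rewrite (leq_trans ik).
move=> ab; rewrite leqNgt; apply/negP => /ab abk'.
by rewrite abk' eqxx in abk.
Qed.

Let cdist_eq0 a b : cdist a b = 0 -> a = b.
Proof.
move=> ab0; apply/funext => i; apply: (cdist_le a b i.+1).1 => //.
by rewrite ab0 exprn_ge0// invr_ge0.
Qed.

Let cdistxx a : cdist a a = 0.
Proof. by rewrite /cdist; case: pselect => // h; exfalso; case: h => n; rewrite eqxx. Qed.

Let cdist_cases a b : cdist a b = 0 \/ exists n, cdist a b = 2^-1 ^+ n.
Proof. by rewrite /cdist; case: pselect => [h|?]; [right; eexists|left]. Qed.

Let cdist_ge0 a b : 0 <= cdist a b.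
Proof. by case: (cdist_cases a b) => [->//|[n ->]]; rewrite exprn_ge0// invr_ge0. Qed.

Let cdist_sym a b : cdist a b = cdist b a.
Proof.
have H x y : cdist x y <= cdist y x.
  case: (cdist_cases y x) => [/cdist_eq0 ->|[n yx]]; first by rewrite cdistxx.
  rewrite yx; apply/cdist_le => i il; apply/esym.
  by apply: (cdist_le y x n).1 => //; rewrite yx.
by apply/eqP; rewrite eq_le !H.
Qed.

(** The ultrametric bound holds: [a] and [c] agree up to the earlier of the two disagreements. *)
Let cdist_triangle b a c : cdist a c <= cdist a b + cdist b c.
Proof.
have [/cdist_eq0 ->|[m abm]] := cdist_cases a b.
  by rewrite cdistxx add0r.
have [/cdist_eq0 ->|[n bcn]] := cdist_cases b c.
  by rewrite cdistxx addr0.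
have [mn|/ltnW nm] := leqP m n.
  rewrite (le_trans _ (_ : cdist a b <= _)) ?lerDl// abm.
  apply/cdist_le => i im; transitivity (b i).
    by apply: (cdist_le a b m).1 => //; rewrite abm.
  by apply: (cdist_le b c n).1; rewrite ?bcn// (leq_trans im).
rewrite (le_trans _ (_ : cdist b c <= _)) ?lerDr// bcn.
apply/cdist_le => i im; transitivity (b i).
  by apply: (cdist_le a b m).1; rewrite ?abm// (leq_trans im).
by apply: (cdist_le b c n).1 => //; rewrite bcn.
Qed.

HB.instance Definition _ := Choice.on (cantor_metric R).

HB.instance Definition _ := @isMetric.Build R (cantor_metric R)
  cdist cdistxx cdist_eq0 cdist_sym cdist_triangle.

Lemma cantor_dist_le a b n :
  mdist a b <= 2^-1 ^+ n :> R <-> forall i, (i < n)%N -> a i = b i.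
Proof. exact: cdist_le. Qed.

Lemma cantor_ballP a b n : ball a (2^-1 ^+ n : R) b -> forall i, (i < n)%N -> a i = b i.
Proof. by rewrite ballEmdist /= => /ltW /cantor_dist_le. Qed.

Lemma cantor_ballS a b n (e : R) : 2^-1 ^+ n < e ->
  (forall i, (i < n)%N -> a i = b i) -> ball a e b.
Proof. by move=> ne /cantor_dist_le ab; rewrite ballEmdist /=; exact: le_lt_trans ne. Qed.

Lemma cantor_open_prefix (O : set (cantor_metric R)) a : open O -> O a ->
  exists n, forall b, (forall i, (i < n)%N -> a i = b i) -> O b.
Proof.
rewrite openE => oO /oO /nbhs_ballP[e /= e0 aeO].
have [n ne] := exists_half_expr e0.
by exists n => b ab; apply: aeO; exact: cantor_ballS ab.
Qed.

Lemma cantor_complete (F : set_system (cantor_metric R)) :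
  ProperFilter F -> cauchy F -> exists x : cantor_metric R, F --> x.
Proof.
move=> FF /cauchyP cF.
have {cF} /choice[x Fx] n : exists x, F (ball x (2^-1 ^+ n : R)).
  by apply: cF; rewrite exprn_gt0// invr_gt0.
(* Bit [i] is read from [x i.+1]: a ball of radius 2^-(i+1) fixes the bits 0 to [i]. *)
pose l : cantor_metric R := fun i => x i.+1 i.
exists l; apply/cvg_ballP => e e0; have [n ne] := exists_half_expr e0.
have : F [set b | forall i, (i < n)%N -> l i = b i].
  elim: n {ne} => [|n IH]; first by apply: filterS filterT.
  apply: filterS (filterI IH (Fx n.+1)) => b [lb /cantor_ballP xb] i.
  by rewrite ltnS leq_eqVlt => /predU1P[->|/lb//]; apply: xb.
by apply: filterS => b; exact: cantor_ballS.
Qed.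

Lemma cantor_separable :
  exists2 D : set (cantor_metric R), countable D & dense D.
Proof.
exists [set (nth false s : cantor_metric R) | s in [set: seq bool]].
  exact: (sub_countable (card_image_le _ _) (countableP _)).
move=> O [a Oa] /cantor_open_prefix /(_ Oa)[n h].
exists (nth false (mkseq a n)); split; last by exists (mkseq a n).
by apply: h => i il; rewrite nth_mkseq.
Qed.

Lemma cantor_borel :
  @measurable _ cantor = <<s [set U : set (cantor_metric R) | open U] >>.
Proof.
apply/seteqP; split.
  apply: smallest_sub; first exact: smallest_sigma_algebra.
  move=> _ [n _ [B mB <-]]; apply: sub_sigma_algebra => /=.
  rewrite setTI openE => a /= Ba; apply/nbhs_ballP.
  exists (2^-1 ^+ n.+1); first by rewrite /= exprn_gt0// invr_gt0.
  by move=> b /cantor_ballP /(_ n); rewrite /preimage /= => <-.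
apply: smallest_sub; first exact: sigma_algebra_measurable.
move=> O /= oO.
(* An open set is the union of the prefix sets inside it, and there are countably many words. *)
rewrite (_ : O = \bigcup_s
    (if pselect (prefix_set s `<=` O) then prefix_set s else set0)).
  apply: (@countable_bigcupT_measurable _ cantor); first exact: countableP.
  move=> s; case: pselect => /= _; last exact: measurable0.
  exact: measurable_prefix_set.
apply/seteqP; split => [a Oa|a [s _]]; last by case: pselect => //= + ?; apply.
have [n h] := cantor_open_prefix oO Oa.
exists (mkseq a n) => //; case: pselect => [?|[]]; first exact: mem_prefix_set.
rewrite prefix_setE size_mkseq => b /= ab; apply: h => i il.
by rewrite ab// nth_mkseq.
Qed.

Lemma standard_borel_cantor : standard_borel R cantor.
Proof.
exists (cantor_metric R), id; split.
- exact: cantor_complete.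
- exact: cantor_separable.
- by exists id.
- rewrite cantor_borel; apply/seteqP; split => [A mA|_ [A mA <-]].
    by exists A => //; rewrite setTI.
  by rewrite setTI.
Qed.

End cantor_metric.

Lemma standard_borel_iso (R : realType) d (T : measurableType d)
    d' (T' : measurableType d') (f : T -> T') (g : T' -> T) :
  cancel f g -> cancel g f ->
  measurable_fun setT f -> measurable_fun setT g ->
  standard_borel R T' -> standard_borel R T.
Proof.
move=> fK gK mf mg [X [phi [cX sX bphi mT']]].
exists X, (phi \o f); split => //.
  by apply: bij_comp => //; exists g.
rewrite preimage_set_system_comp -mT'; apply/seteqP; split => [A mA|_ [A mA <-]].
  exists (g @^-1` A); first by rewrite -[X in measurable X]setTI; exact: mg.
  by rewrite setTI; apply/seteqP; split => x /=; rewrite /preimage /= fK.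
exact: mf.
Qed.

(** This is the space of the dilation; interleaving bits identifies it with Cantor space. *)
Lemma standard_borel_cantor_pair (R : realType) :
  standard_borel R (cantor * cantor)%type.
Proof.
pose f (x : cantor * cantor) : cantor :=
  fun n => if odd n then x.2 n./2 else x.1 n./2.
pose g (w : cantor) : cantor * cantor := (fun n => w n.*2, fun n => w n.*2.+1).
apply: (@standard_borel_iso R _ _ _ cantor f g); last exact: standard_borel_cantor.
- move=> [a b]; rewrite /f /g /=; congr pair; apply/funext => n.
    by rewrite odd_double doubleK.
  by rewrite /= odd_double /= uphalf_double.
- move=> w; rewrite /f /g /=; apply/funext => n.
  by rewrite -[in RHS](odd_double_half n); case: (odd n).
- apply: measurable_to_seqspace => n; rewrite /f; case: (odd n).
    by apply: (measurableT_comp (measurable_coord _)); exact: measurable_snd.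
  by apply: (measurableT_comp (measurable_coord _)); exact: measurable_fst.
- by apply: measurable_fun_pair; apply: measurable_to_seqspace => n;
     exact: measurable_coord.
Qed.

(** * Sampling a bit sequence from its prefix probabilities *)

Section tree_sampling.
Context {R : realType}.
Implicit Types (p : seq bool -> R) (u : R) (s : seq bool).

(** If [p s] is the probability of the prefix [s], then [0,1) is cut into intervals of these lengths
    in lexicographic order; the interval of [s] starts after the masses of all words that branch off
    to its left. *)
Definition left_end p s : R :=
  \sum_(i < size s) if nth false s i then p (rcons (take i s) false) else 0.

Lemma left_end_rcons p s b :
  left_end p (rcons s b) = left_end p s + if b then p (rcons s false) else 0.
Proof.
rewrite /left_end size_rcons big_ord_recr /= nth_rcons ltnn eqxx.
rewrite -cats1 take_size_cat//; congr (_ + _); apply: eq_bigr => i _.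
by rewrite nth_cat ltn_ord takel_cat// ltnW.
Qed.

Definition next_bit p u s := left_end p s + p (rcons s false) <= u.

Fixpoint sample_word p u n :=
  if n is m.+1 then rcons (sample_word p u m) (next_bit p u (sample_word p u m))
  else [::].

(** Inverse transform sampling along the binary tree: each bit tells in which of the two parts of
    the current interval [u] lies. *)
Definition sample p u : cantor := fun n => next_bit p u (sample_word p u n).

Lemma mkseq_sample p u n : mkseq (sample p u) n = sample_word p u n.
Proof. by elim: n => //= n IH; rewrite mkseqS IH. Qed.

(** The prefix probabilities of a probability measure on Cantor space have these properties;
    [unif01_sample] shows that conversely each such family comes from a measure. *)
Definition consistent p := [/\ p [::] = 1, forall s, 0 <= p s &
  forall s, p s = p (rcons s false) + p (rcons s true)].

(** Appending a bit cuts the interval of [s] at [left_end p s + p (rcons s false)], which is the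
    threshold in [next_bit]. *)
Lemma sample_prefixE p u s : consistent p -> 0 <= u < 1 ->
  prefix_set s (sample p u) <-> left_end p s <= u < left_end p s + p s.
Proof.
move=> [p1 p0 pS] u01; rewrite /prefix_set /= mkseq_sample.
elim/last_ind: s => [|s b IH].
  by rewrite /= /left_end big_ord0 add0r p1 u01.
rewrite size_rcons /= left_end_rcons.
have -> : rcons (sample_word p u (size s)) (next_bit p u (sample_word p u (size s)))
    = rcons s b <-> sample_word p u (size s) = s /\ next_bit p u s = b.
  by split => [/rcons_inj[-> <-]//|[-> ->]].
rewrite IH /next_bit; have := p0 (rcons s false); have := p0 (rcons s true).
have := pS s; case: b => pSs p1s p0s; split.
- by move=> [/andP[? ?] ?]; apply/andP; split; lra.
- by move=> /andP[? ?]; split => //; apply/andP; split; lra.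
- move=> [/andP[? ?] /negbT]; rewrite -ltNge => ?; apply/andP; split; lra.
- move=> /andP[? ?]; split; first by apply/andP; split; lra.
  by apply/negbTE; rewrite -ltNge; lra.
Qed.

End tree_sampling.

Section measurable_tree_sampling.
Context d (Y : measurableType d) (R : realType) (p : Y -> seq bool -> R).
Hypothesis mp : forall s, measurable_fun setT (p^~ s).

Lemma measurable_left_end s : measurable_fun setT (fun y => left_end (p y) s).
Proof.
rewrite /left_end; apply: measurable_sum => i.
by case: (nth false s i) => //; exact: mp.
Qed.

Let next_bit_set s : set (Y * R) := [set yu | next_bit (p yu.1) yu.2 s].

Let measurable_next_bit_set s : measurable (next_bit_set s).
Proof.
have : measurable_fun setT (fun yu : Y * R => next_bit (p yu.1) yu.2 s).
  apply: measurable_fun_ler; last exact: measurable_snd.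
  apply: measurable_funD.
    by apply: (measurableT_comp (measurable_left_end s)); exact: measurable_fst.
  by apply: (measurableT_comp (mp _)); exact: measurable_fst.
by move=> /(_ measurableT [set true]); rewrite setTI; apply.
Qed.

Let word_set s : set (Y * R) := [set yu | sample_word (p yu.1) yu.2 (size s) = s].

Let measurable_word_set s : measurable (word_set s).
Proof.
elim/last_ind: s => [|s b IH].
  by rewrite (_ : word_set _ = setT)//; apply/seteqP; split.
rewrite (_ : word_set _ =
    word_set s `&` if b then next_bit_set s else ~` next_bit_set s).
  by apply: measurableI => //; case: b => //; exact: measurableC.
apply/seteqP; split => -[y u]; rewrite /word_set /next_bit_set /= size_rcons /=.
  by move=> /rcons_inj[-> <-]; split=> //; case: ifPn => //= /negP.
by move=> [-> ]; case: b => /= [->//|/negP/negbTE ->].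
Qed.

Lemma measurable_sample :
  measurable_fun setT (fun yu : Y * R => sample (p yu.1) yu.2).
Proof.
apply: measurable_to_seqspace => n.
apply: (@measurable_fun_bool _ _ _ _ true); rewrite setTI.
(* Bit [n] is decided by the word of the first [n] bits, which takes countably many values. *)
rewrite (_ : _ @^-1` _ = \bigcup_s
    (if size s == n then word_set s `&` next_bit_set s else set0)).
  apply: (@countable_bigcupT_measurable _ (Y * R)%type); first exact: countableP.
  by move=> s; case: ifP => // _; exact: measurableI.
have size_word (q : seq bool -> R) u : size (sample_word q u n) = n.
  by rewrite -mkseq_sample size_mkseq.
apply/seteqP; split => [[y u] /= h|[y u] [s _]].
  by exists (sample_word (p y) u n); rewrite //= size_word eqxx /word_set /= size_word.
case: eqP => // <- [] /=; rewrite /word_set /next_bit_set /preimage /sample /=.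
by move=> ->.
Qed.

End measurable_tree_sampling.

Lemma measurable_sample1 (R : realType) (p : seq bool -> R) :
  measurable_fun setT (sample p : R -> cantor).
Proof.
have mt : measurable_fun setT (fun u : R => (tt, u)) by apply: measurable_fun_pair.
have ms := @measurable_sample _ unit R (fun=> p) (fun=> measurable_cst _).
exact: (measurableT_comp ms mt).
Qed.

(** * Uniform numbers and fair coin tosses *)

Section coin.
Context {R : realType}.

Definition unif01 := mrestr (@lebesgue_measure R) (measurable_itv `[0, 1[).

HB.instance Definition _ := Measure.on unif01.

Let unif01_setT : unif01 setT = 1%:E.
Proof.
rewrite /unif01 /mrestr setTI lebesgue_measure_itv /= lte01 sube0 //.
Qed.

HB.instance Definition _ := Measure_isProbability.Build _ _ _ unif01 unif01_setT.

Lemma unif01_sample (p : seq bool -> R) s :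
  consistent p -> unif01 (sample p @^-1` prefix_set s) = (p s)%:E.
Proof.
move=> cp; have [p1 p0 pS] := cp.
(* The interval of [s] stays inside the unit interval, so restricting Lebesgue measure to [0,1)
   removes none of its length. *)
have bnd : 0 <= left_end p s /\ left_end p s + p s <= 1.
  elim/last_ind: s => [|s b IH].
    by rewrite /left_end big_ord0 p1 add0r.
  move: IH; rewrite left_end_rcons.
  have := p0 (rcons s false); have := p0 (rcons s true); have := pS s.
  by case: b => ? ? ? [? ?]; split; lra.
rewrite /unif01 /mrestr (_ : _ `&` _ = `[left_end p s, left_end p s + p s[%classic).
  rewrite lebesgue_measure_itv /= lte_fin ltrDl.
  case: ltP => [_|ps0]; first by rewrite -EFinB addrAC subrr add0r.
  by congr EFin; apply/eqP; rewrite eq_le p0 ps0.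
apply/seteqP; split => u /=; rewrite !in_itv /=.
  by move=> [h u01]; apply/sample_prefixE.
move=> h; have u01 : 0 <= u < 1 by move: h => /andP[? ?]; apply/andP; split; lra.
by split => //; apply/sample_prefixE.
Qed.

Definition fair (s : seq bool) : R := 2^-1 ^+ size s.

Lemma consistent_fair : consistent fair.
Proof.
split => [|s|s]; first by rewrite /fair expr0.
  by rewrite exprn_ge0// invr_ge0.
by rewrite /fair !size_rcons !exprS; set x := _ ^+ size s; lra.
Qed.

Lemma left_end_fair (c : cantor) n :
  left_end fair (mkseq c n) = \sum_(i < n) if c i then 2^-1 ^+ i.+1 else 0.
Proof.
rewrite /left_end size_mkseq; apply: eq_bigr => i _.
by rewrite nth_mkseq// /fair size_rcons size_takel// size_mkseq ltnW.
Qed.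

Definition fair_sample : measurableTypeR R -> cantor := sample fair.

Let measurable_fair_sample : measurable_fun setT fair_sample.
Proof.
exact: measurable_sample1.
Qed.

HB.instance Definition _ :=
  isMeasurableFun.Build _ _ _ _ fair_sample measurable_fair_sample.

(** The infinite product of fair coins, obtained as the law of the binary digits of a uniform
    number. *)
Definition coin : set cantor -> \bar R := distribution unif01 fair_sample.

HB.instance Definition _ := Probability.on coin.

Lemma coin_prefix s : coin (prefix_set s) = (2^-1 ^+ size s)%:E.
Proof. exact: unif01_sample consistent_fair. Qed.

(* The partial sums of the digits of [u] converge to [u], so the choice of
   [limn_esup] over any other limit is immaterial in [binary_valueK]. *)
Definition binary_value (c : cantor) : R :=
  fine (limn_esup (fun n => (left_end fair (mkseq c n))%:E)).

Lemma measurable_binary_value : measurable_fun setT binary_value.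
Proof.
apply: (measurableT_comp (fine_measurable _)) => //.
apply: measurable_fun_limn_esup => n; apply/measurable_EFinP.
rewrite [X in measurable_fun _ X](_ : _ = fun c : cantor =>
    \sum_(i < n) if c i then 2^-1 ^+ i.+1 else 0); last first.
  by apply/funext => c; rewrite left_end_fair.
apply: measurable_sum => i; apply: measurable_fun_ifT => //.
exact: measurable_coord.
Qed.

(** The first [n] digits confine [u] to an interval of length 2^-n that starts at their partial
    sum. *)
Lemma binary_valueK u : 0 <= u < 1 -> binary_value (sample fair u) = u.
Proof.
move=> u01; rewrite /binary_value.
suff /cvg_limn_einf_sup[_ ->] :
  (left_end fair (mkseq (sample fair u) n))%:E @[n --> \oo] --> u%:E by [].
apply: cvg_EFin; first exact: nearW.
apply/cvgrPdist_lt => e e0; have [N Ne] := exists_half_expr e0.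
exists N => // n /= Nn.
have /(sample_prefixE _ consistent_fair u01) := mem_prefix_set n (sample fair u).
have -> : fair (mkseq (sample fair u) n) = 2^-1 ^+ n by rewrite /fair size_mkseq.
move=> /andP[lu ul].
rewrite /= ger0_norm ?subr_ge0// (le_lt_trans _ Ne)// (le_trans _ (_ : 2^-1 ^+ n <= _))//.
  by rewrite lerBlDl ltW.
by rewrite half_exprP.
Qed.

(** Coin tosses become a uniform number: [coin] is the law of the digits, and reading them back is
    the identity on [0,1), which carries [unif01]. *)
Lemma coin_binary_value A : measurable A -> coin (binary_value @^-1` A) = unif01 A.
Proof.
move=> mA; rewrite /coin /distribution /pushforward /unif01 /mrestr.
congr lebesgue_measure; apply/seteqP; split => u /= [Au]; rewrite in_itv /= => u01.
all: split => //; rewrite ?in_itv//; move: Au; rewrite /preimage /=.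
all: by rewrite (binary_valueK u01 : binary_value (fair_sample u) = u).
Qed.

End coin.

(** * Functional representation of a transition kernel *)

Lemma product_measure_graphE d1 (T1 : measurableType d1) d2 (T2 : measurableType d2)
    d3 (T3 : measurableType d3) (R : realType)
    (m1 : {measure set T1 -> \bar R}) (m2 : {measure set T2 -> \bar R})
    (g : T1 * T2 -> T3) (A : set T1) (B : set T3) :
  (m1 \x m2)%E ((A `*` setT) `&` g @^-1` B) =
  (\int[m1]_(y in A) m2 [set c | B (g (y, c))])%E.
Proof.
rewrite /product_measure1 [RHS]integral_mkcond; apply: eq_integral => y _ /=.
rewrite patchE; case: ifPn => yA.
  congr (m2 _); apply/seteqP; split => c; rewrite /xsection /= inE /=.
    by move=> [].
  by move=> gB; split => //; split => //; rewrite -inE.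
rewrite (_ : xsection _ _ = set0) ?measure0//; apply/seteqP; split => // c.
rewrite /xsection /= inE /= => -[[/= + _] _]; rewrite notin_setE in yA.
exact: yA.
Qed.

Lemma measurable_graph_section d1 (T1 : measurableType d1) d2 (T2 : measurableType d2)
    d3 (T3 : measurableType d3) (R : realType)
    (m2 : {sigma_finite_measure set T2 -> \bar R})
    (g : {mfun (T1 * T2)%type >-> T3}) (B : set T3) : measurable B ->
  measurable_fun setT (fun y => m2 [set c | B (g (y, c))]).
Proof.
move=> mB; have mgB := measurable_funPTI g mB.
have := measurable_fun_xsection m2 mgB; congr measurable_fun.
apply/funext => y /=; congr (m2 _); apply/seteqP.
by split => c; rewrite /xsection /= inE.
Qed.

Section kernel_representation.
Context d (T : measurableType d) (R : realType) (mu : probability T R).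
Variables Y0 Y1 : {mfun T >-> cantor}.
Let pi := distribution mu Y0.

(** Its density with respect to [pi] is the conditional probability, given [Y0], that [Y1] begins
    with [s]. *)
Let nu_fin (s : seq bool) :=
  restricted_law mu (measurable_funPTI Y1 (measurable_prefix_set s)) Y0.

Let nu_finE s A : nu_fin s A = mu (Y1 @^-1` prefix_set s `&` Y0 @^-1` A).
Proof. exact: restricted_lawE. Qed.

Let nu_dom s : nu_fin s `<< pi.
Proof.
apply/null_content_dominatesP => A mA piA0; apply/eqP; rewrite nu_finE.
rewrite -measure_le0 -[leRHS]piA0 /pi /distribution /pushforward.
apply: le_measure; rewrite ?inE//.
- by apply: measurableI; apply: measurable_funPTI => //; exact: measurable_prefix_set.
- exact: measurable_funPTI.
Qed.

(** The densities of [nu_fin] are the prefix probabilities of a transition kernel, and [sample]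
    driven by a uniform number realizes it. At states where the family fails to be consistent [g] is
    left as it comes, since these form a null set. *)
Lemma exists_kernel_representation : exists g : {mfun (cantor * cantor)%type >-> cantor},
  forall A B, measurable A -> measurable B ->
  (\int[pi]_(y in A) coin [set c | B (g (y, c))] =
   mu (Y0 @^-1` A `&` Y1 @^-1` B) :> \bar R)%E.
Proof.
have /choice[q qP] s : exists q : cantor -> \bar R, [/\ forall y, (0 <= q y)%E,
    forall y, q y \is a fin_num, pi.-integrable setT q &
    forall A, measurable A -> nu_fin s A = (\int[pi]_(y in A) q y)%E].
  exact: radon_nikodym_sigma_finite (nu_dom s).
pose p y s := fine (q s y).
have pE s y : (p y s)%:E = q s y by rewrite fineK//; have [_ + _ _] := qP s; apply.
have p_ge0 y s : 0 <= p y s by apply: fine_ge0; have [+ _ _ _] := qP s; apply.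
have mq s : measurable_fun setT (q s).
  by have [_ _ iq _] := qP s; exact: measurable_int iq.
have mp s : measurable_fun setT (p^~ s).
  by apply: (measurableT_comp (fine_measurable _)) => //.
have iq s A : measurable A -> (\int[pi]_(y in A) q s y)%E = nu_fin s A.
  by move=> mA; have [_ _ _ ->] := qP s.
(* The empty prefix imposes nothing: its density is that of [pi] itself. *)
have p_root : \forall y \ae pi, p y [::] = 1.
  have [_ _ intq _] := qP [::].
  have := @integral_ae_eq _ _ _ pi setT measurableT (cst 1%E) (q [::]) intq
    (measurable_cst _) _.
  have h : forall E, E `<=` setT -> measurable E ->
     (\int[pi]_(x in E) q [::] x = \int[pi]_(x in E) cst 1 x)%E.
    move=> E _ mE; rewrite iq// integral_cst// mul1e nu_finE.
    by rewrite prefix_setT preimage_setT setTI.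
  move=> /(_ h); apply: filterS => y /(_ I); rewrite -pE => -[].
  by rewrite /cst => ->.
(* The two extensions of [s] by one bit split its event into disjoint events. *)
have p_split s : \forall y \ae pi, p y s = p y (rcons s false) + p y (rcons s true).
  have [_ _ intq _] := qP s.
  have msum : measurable_fun setT (fun y => q (rcons s false) y + q (rcons s true) y)%E.
    exact: emeasurable_funD.
  have := @integral_ae_eq _ _ _ pi setT measurableT _ (q s) intq msum.
  have h : forall E, E `<=` setT -> measurable E -> (\int[pi]_(x in E) q s x =
      \int[pi]_(x in E) (q (rcons s false) x + q (rcons s true) x))%E.
    move=> E _ mE; rewrite ge0_integralD//; first last.
    + exact: measurable_funTS.
    + by move=> x _; have [+ _ _ _] := qP (rcons s true); apply.
    + exact: measurable_funTS.
    + by move=> x _; have [+ _ _ _] := qP (rcons s false); apply.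
    rewrite !iq// !nu_finE -measureU//.
    + congr (mu _); rewrite -setIUl; congr (_ `&` _).
      rewrite !prefix_setE; apply/seteqP; split => x /=.
        move=> xs; have [Y1s|Y1s] := boolP (Y1 x (size s)); [right|left];
          move=> i; rewrite size_rcons ltnS leq_eqVlt nth_rcons => /orP[/eqP ->|il].
        * by rewrite ltnn eqxx.
        * by rewrite il xs.
        * by rewrite ltnn eqxx; exact/negbTE.
        * by rewrite il xs.
      move=> [] h i il; have := h i; rewrite size_rcons nth_rcons il; apply;
        by rewrite ltnS ltnW.
    + by apply: measurableI; apply: measurable_funPTI => //; exact: measurable_prefix_set.
    + by apply: measurableI; apply: measurable_funPTI => //; exact: measurable_prefix_set.
    + apply/seteqP; split => // x [[+ _] [+ _]]; rewrite !prefix_setE /=.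
      move=> /(_ (size s)) + /(_ (size s)); rewrite !size_rcons !nth_rcons ltnn eqxx.
      by move=> /(_ (ltnSn _)) -> /(_ (ltnSn _)).
  move=> /(_ h); apply: filterS => y /(_ I).
  by rewrite -!pE -EFinD => -[].
have p_cons : \forall y \ae pi, consistent (p y).
  (* Words are enumerated by [pickle], because almost sure statements are intersected over the
     naturals; a number that codes no word imposes nothing. *)
  pose P n y := if unpickle n is Some s then
     p y s = p y (rcons s false) + p y (rcons s true) else True.
  have : \forall y \ae pi, forall n, P n y.
    apply: ae_foralln => n; rewrite /P; case: (unpickle n) => [s|]; first exact: p_split.
    exact: nearW.
  apply: filterS2 p_root => y p1 pS; split => // s.
  by have := pS (pickle s); rewrite /P pickleK.
pose gf (yc : cantor * cantor) := sample (p yc.1) (@binary_value R yc.2).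
have mg : measurable_fun setT gf.
  have mV : measurable_fun setT
      (fun yc : cantor * cantor => (yc.1, @binary_value R yc.2)).
    apply: measurable_fun_pair => //.
    exact: (measurableT_comp measurable_binary_value measurable_snd).
  exact: (measurableT_comp (measurable_sample mp) mV).
pose g : {mfun (cantor * cantor)%type >-> cantor} :=
  HB.pack gf (isMeasurableFun.Build _ _ _ _ gf mg).
exists g => A B mA mB.
have mAT : measurable (A `*` (@setT cantor)) by exact: measurableX.
rewrite -product_measure_graphE.
pose P := [the probability _ R of (distribution mu Y0 \x coin)%E].
transitivity (restricted_law P mAT g B); first exact/esym/restricted_lawE.
transitivity (restricted_law mu (measurable_funPTI Y0 mA) Y1 B); last first.
  exact: restricted_lawE.
(* Both sides are finite measures in [B], hence may be compared on prefix sets, where the inner mass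
   is [p y s] almost surely. *)
apply: cantor_measure_unique => // s.
transitivity ((P : set _ -> \bar R) ((A `*` setT) `&` g @^-1` prefix_set s)).
  exact: restricted_lawE.
transitivity (mu (Y0 @^-1` A `&` Y1 @^-1` prefix_set s)); last first.
  exact/esym/restricted_lawE.
rewrite /P /=product_measure_graphE setIC -nu_finE -iq//.
apply: ae_eq_integral => //.
- apply: measurable_funTS.
  exact: (@measurable_graph_section _ cantor _ cantor _ cantor R coin g _
    (measurable_prefix_set s)).
- exact: measurable_funTS.
apply: filterS p_cons => y cy _; rewrite -pE -(unif01_sample s cy).
rewrite -coin_binary_value// -[X in measurable X]setTI.
by apply: measurable_sample1 => //; exact: measurable_prefix_set.
Qed.

End kernel_representation.

(** * Rows of a sequence of coin tosses *)

Section coin_coordinates.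
Context {R : realType}.
Implicit Types (K : seq nat) (v : seq bool).

Let cyl K v : set cantor := [set w | [seq w k | k <- K] = v].

Let measurable_cyl K v : measurable (cyl K v).
Proof.
elim: K v => [|k K IH] [|b v].
- by rewrite (_ : cyl _ _ = setT)//; apply/seteqP; split.
- by rewrite (_ : cyl _ _ = set0)//; apply/seteqP; split.
- by rewrite (_ : cyl _ _ = set0)//; apply/seteqP; split.
rewrite (_ : cyl _ _ = (fun w : cantor => w k) @^-1` [set b] `&` cyl K v).
  apply: measurableI => //; rewrite -[X in measurable X]setTI.
  exact: measurable_coord.
by apply/seteqP; split => w; rewrite /cyl /= => -[-> ->].
Qed.

(** Induction on the number of indices below a bound [N] that [K] misses: a missing index splits the
    cylinder in two, and once none is missing the cylinder is a prefix set up to the order of the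
    indices. *)
Lemma coin_coordinates K v : uniq K -> size v = size K ->
  @coin R [set w | [seq w k | k <- K] = v] = (2^-1 ^+ size K)%:E.
Proof.
pose N := (\max_(k <- K) k).+1.
have : {subset K <= iota 0 N}.
  by move=> k kK; rewrite mem_iota add0n ltnS; exact: leq_bigmax_seq.
move: N => N KN uK; have := uniq_leq_size uK KN; rewrite size_iota => /subnKC.
move: (N - size K)%N => m; elim: m K v KN uK => [|m IH] K v KN uK sK vK.
  rewrite (_ : [set w | _] =
      prefix_set (mkseq (fun i => nth false v (index i K)) N)).
    by rewrite coin_prefix size_mkseq -sK addn0.
  have NK : K =i iota 0 N.
    by apply: (uniq_min_size uK KN _).2; rewrite size_iota -sK addn0.
  apply/seteqP; split => w /=.
    move=> wK; rewrite prefix_setE size_mkseq /= => i iN; rewrite nth_mkseq//.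
    have iK : i \in K by rewrite NK mem_iota.
    by rewrite -wK (nth_map 0%N) ?index_mem// nth_index.
  rewrite prefix_setE size_mkseq /= => wK.
  apply: (@eq_from_nth _ false); rewrite size_map// => i il.
  rewrite (nth_map 0%N)//; have : nth 0%N K i \in K by exact: mem_nth.
  rewrite NK mem_iota add0n /= => kN; rewrite wK// nth_mkseq//.
  by rewrite index_uniq.
have [i iN iK] : exists2 i, (i < N)%N & i \notin K.
  apply/not_exists2P => allK.
  have : (size (iota 0 N) <= size K)%N.
    apply: uniq_leq_size; first exact: iota_uniq.
    move=> i; rewrite mem_iota add0n /= => iN; apply/negPn/negP => iK.
    by case: (allK i).
  by rewrite size_iota -sK addnS ltnNge leq_addr.
have S b : @coin R (cyl (i :: K) (b :: v)) = (2^-1 ^+ (size K).+1)%:E.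
  apply: IH => //=.
  - by move=> k; rewrite inE => /predU1P[->|/KN//]; rewrite mem_iota.
  - by rewrite iK.
  - by rewrite addSnnS.
  - by rewrite vK.
rewrite (_ : [set w | _] = cyl (i :: K) (true :: v) `|` cyl (i :: K) (false :: v)).
  transitivity (@coin R (cyl (i :: K) (true :: v)) + @coin R (cyl (i :: K) (false :: v)))%E.
    apply: measureU => //; apply/seteqP; split => // w [] [wt _] [wf _].
    by rewrite wt in wf.
  by rewrite !S -EFinD exprS; congr EFin; set x := _ ^+ _; lra.
apply/seteqP; split => w; rewrite /cyl /=.
  by move=> <-; case: (w i); [left|right].
by move=> [] [].
Qed.

End coin_coordinates.

Section noise_rows.
Variables (enc : nat * nat -> nat) (dec : nat -> nat * nat).
Hypotheses (encK : cancel enc dec) (decK : cancel dec enc).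

Definition row0 (c : cantor) : cantor := fun j => c (enc (0%N, j)).

(** [bump k] skips the value [k]: row [i] of the new array is row [i] of the old one below [k], and
    row [i.+1] from [k] on. *)
Let del_index k n := enc (bump k (dec n).1, (dec n).2).

Definition delete_row k (c : cantor) : cantor := fun n => c (del_index k n).

Let del_index_inj k : injective (del_index k).
Proof.
move=> m n /(can_inj encK)[] /(can_inj (bumpK k)) e1 e2; apply: (can_inj decK).
by rewrite [LHS]surjective_pairing [RHS]surjective_pairing e1 e2.
Qed.

(** The coface identity of [bump]: what is row [l] once row [k <= l] is gone was row [l.+1]
    before. *)
Lemma delete_row_comm k l c : (k <= l)%N ->
  delete_row l (delete_row k c) = delete_row k (delete_row l.+1 c).
Proof.
move=> kl; apply/funext => n; rewrite /delete_row /del_index !encK /=.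
have e1 : bump k l = l.+1 by rewrite /bump kl.
have e2 : unbump l k = k by rewrite /unbump ltnNge kl subn0.
by rewrite bumpC e1 e2.
Qed.

Lemma row0_delete_row k c : (0 < k)%N -> row0 (delete_row k c) = row0 c.
Proof.
by move=> k0; apply/funext => j; rewrite /row0 /delete_row /del_index encK /= /bump leqNgt k0.
Qed.

Lemma measurable_row0 : measurable_fun setT row0.
Proof. by apply: measurable_to_seqspace => n; exact: measurable_coord. Qed.

Lemma measurable_delete_row k : measurable_fun setT (delete_row k).
Proof. by apply: measurable_to_seqspace => n; exact: measurable_coord. Qed.

HB.instance Definition _ := isMeasurableFun.Build _ _ _ _ row0 measurable_row0.

HB.instance Definition _ k :=
  isMeasurableFun.Build _ _ _ _ (delete_row k) (measurable_delete_row k).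

Context {R : realType}.

(** Deletion reads distinct coordinates, so a prefix set pulls back to a cylinder of the same
    length. *)
Lemma coin_delete_row k A : measurable A -> @coin R (delete_row k @^-1` A) = coin A.
Proof.
pose P := [the probability _ R of distribution (@coin R) (delete_row k)].
move=> mA; transitivity (P A) => //; apply: cantor_measure_unique => // s.
transitivity ((2^-1 ^+ size s)%:E : \bar R); last first.
  by rewrite -(coin_prefix s).
rewrite -[in RHS](size_iota 0 (size s)) -(size_map (del_index k)).
rewrite -(coin_coordinates (v := s)) ?size_map ?size_iota//.
- congr (coin _); apply/seteqP; split => c;
  by rewrite /prefix_set /preimage /= -map_comp.
- by rewrite map_inj_uniq ?iota_uniq.
Qed.

Let coin_row0_prefix s t :
  @coin R (row0 @^-1` prefix_set s `&` delete_row 0 @^-1` prefix_set t) =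
  (@coin R (prefix_set s) * @coin R (prefix_set t))%E.
Proof.
pose K0 := [seq enc (0%N, j) | j <- iota 0 (size s)].
pose K1 := [seq del_index 0 j | j <- iota 0 (size t)].
rewrite !coin_prefix -EFinM -exprD.
have sK : size (K0 ++ K1) = (size s + size t)%N.
  by rewrite size_cat !size_map !size_iota.
rewrite -sK -(coin_coordinates (v := s ++ t)) ?sK ?size_cat//.
- congr (coin _); apply/seteqP; split => c;
    rewrite /K0 /K1 /prefix_set /preimage /= map_cat -!map_comp.
    by move=> [ls lt]; congr cat.
  move=> /eqP; rewrite eqseq_cat ?size_map ?size_iota//.
  by move=> /andP[/eqP ? /eqP ?].
(* [bump 0] never takes the value 0, so the two groups of coordinates are disjoint. *)
- rewrite cat_uniq /K0 /K1 !map_inj_uniq ?iota_uniq//=; last first.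
    by move=> i j /(can_inj encK)[].
  rewrite andbT; apply/hasPn => _ /mapP[j _ ->]; apply/mapP => -[i _].
  by move=> /(can_inj encK)[].
Qed.

(** Disjoint coordinates give the product on prefix sets; uniqueness of measures extends it to [B]
    and then to [A], each time with a multiple of [coin] on the right. *)
Lemma coin_row0_delete_row A B : measurable A -> measurable B ->
  @coin R (row0 @^-1` A `&` delete_row 0 @^-1` B) = (@coin R A * @coin R B)%E.
Proof.
move=> mA mB.
have scale D (mD : measurable D) : exists m : {finite_measure set cantor -> \bar R},
    forall E, m E = (coin D * coin E)%E.
  have cD : (fine (@coin R D))%:E = coin D by rewrite fineK// fin_num_measure.
  exists [the {finite_measure set _ -> \bar R} of
    mscale (NngNum (fine_ge0 (measure_ge0 (@coin R) D))) (@coin R)] => E.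
  by rewrite /= /mscale /= cD.
have prefixB s : @coin R (row0 @^-1` prefix_set s `&` delete_row 0 @^-1` B) =
    (@coin R (prefix_set s) * @coin R B)%E.
  have [m mE] := scale _ (measurable_prefix_set s).
  have mrs := measurable_funPTI row0 (measurable_prefix_set s).
  rewrite -mE; transitivity (restricted_law (@coin R) mrs (delete_row 0) B).
    exact/esym/restricted_lawE.
  apply: cantor_measure_unique => // t; rewrite mE -coin_row0_prefix.
  exact: restricted_lawE.
have [m mE] := scale _ mB.
have mdB := measurable_funPTI (delete_row 0) mB.
rewrite muleC -mE; transitivity (restricted_law (@coin R) mdB row0 A).
  by rewrite setIC; exact/esym/restricted_lawE.
apply: cantor_measure_unique => // s; rewrite mE muleC -prefixB setIC.
exact: restricted_lawE.
Qed.

End noise_rows.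

(** * The dilation of a Markov chain *)

Section markov_dilation.
Variables (enc : nat * nat -> nat) (dec : nat -> nat * nat).
Hypotheses (encK : cancel enc dec) (decK : cancel dec enc).
Variable g : {mfun (cantor * cantor)%type >-> cantor}.

Definition markov_shift (z : cantor * cantor) : cantor * cantor :=
  (g (z.1, row0 enc z.2), delete_row enc dec 0 z.2).

Definition noise_shift k (z : cantor * cantor) : cantor * cantor :=
  (z.1, delete_row enc dec k z.2).

Lemma measurable_markov_shift : measurable_fun setT markov_shift.
Proof.
apply: measurable_fun_pair.
  apply: measurableT_comp => //; apply: measurable_fun_pair => //.
  by apply: measurableT_comp => //; exact: measurable_row0.
by apply: measurableT_comp => //; exact: measurable_delete_row.
Qed.

Lemma measurable_noise_shift k : measurable_fun setT (noise_shift k).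
Proof.
apply: measurable_fun_pair => //.
by apply: measurableT_comp => //; exact: measurable_delete_row.
Qed.

HB.instance Definition _ :=
  isMeasurableFun.Build _ _ _ _ markov_shift measurable_markov_shift.

HB.instance Definition _ k :=
  isMeasurableFun.Build _ _ _ _ (noise_shift k) (measurable_noise_shift k).

Definition dilation_map k : {mfun (cantor * cantor)%type >-> (cantor * cantor)%type} :=
  if k is 0%N then markov_shift else noise_shift k.

Lemma dilation_map_comm k l : (k < l)%N ->
  dilation_map l \o dilation_map k = dilation_map k \o dilation_map l.+1.
Proof.
case: l => // l; case: k => [_|k kl]; apply/funext => -[y c] /=.
  rewrite /noise_shift /markov_shift /= row0_delete_row//.
  by rewrite (delete_row_comm encK).
by rewrite /noise_shift /= (delete_row_comm encK)// ltnW.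
Qed.

Context {R : realType}.

(** The new state looks at row 0 only and the new noise at the other rows, so the mass of a section
    factors. The set [D] carries a condition on the present state through the induction on time. *)
Lemma markov_shift_rectangle (m : {measure set cantor -> \bar R}) D A B :
  measurable D -> measurable A -> measurable B ->
  (m \x @coin R)%E ((D `*` setT) `&` markov_shift @^-1` (A `*` B)) =
  (\int[m]_(y in D) @coin R [set c | A (g (y, c))] * @coin R B)%E.
Proof.
move=> mD mA mB; rewrite product_measure_graphE.
have mgA : measurable_fun setT (fun y => @coin R [set c | A (g (y, c))]).
  exact: (@measurable_graph_section _ cantor _ cantor _ cantor R (@coin R) g _ mA).
rewrite -ge0_integralZr//; last exact: measurable_funTS.
apply: eq_integral => y _.
have mAy : measurable [set c | A (g (y, c))].
  have mgy : measurable_fun setT (fun c => g (y, c)).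
    by apply: measurableT_comp => //; exact: measurable_fun_pair.
  by have := mgy measurableT A mA; rewrite setTI.
by rewrite -(coin_row0_delete_row encK decK).
Qed.

Context d (T : measurableType d) (mu : probability T R).
Variable Y : nat -> {mfun T >-> cantor}.

(** Times strictly below [n], so that the state at time [n] is free for the next transition. *)
Definition past (A : nat -> set cantor) n := [set x | forall i, (i < n)%N -> A i (Y i x)].

Lemma measurable_past A n : (forall i, measurable (A i)) -> measurable (past A n).
Proof.
move=> mA; have mY : measurable_fun setT (fun x => (Y ^~ x : seqspace cantor)).
  by apply: measurable_to_seqspace.
have := mY measurableT _ (measurable_cylinder n mA); rewrite setTI; apply.
Qed.

(** The Markov property with one kernel for all times, in integrated form; [markov_transition]
    establishes it. *)
Hypothesis Y_markov : forall n A B (mA : forall i, measurable (A i)), measurable B ->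
  mu (past A n.+1 `&` Y n.+1 @^-1` B) =
  (\int[restricted_law mu (measurable_past n mA) (Y n)]_(y in A n)
    @coin R [set c | B (g (y, c))])%E.

Hypothesis Y_stat : forall A, measurable A -> mu (Y 1%N @^-1` A) = mu (Y 0%N @^-1` A).

Definition dilation := (distribution mu (Y 0%N) \x @coin R)%E.

HB.instance Definition _ := Probability.on dilation.

Definition dilation_past (A : nat -> set cantor) n :=
  [set z | forall i, (i < n)%N -> A i (iter i markov_shift z).1].

Lemma measurable_iter_markov_shift n : measurable_fun setT (iter n markov_shift).
Proof.
elim: n => [|n IH]; first exact: measurable_id.
by rewrite iterfS; exact: measurableT_comp.
Qed.

HB.instance Definition _ n := isMeasurableFun.Build _ _ _ _
  (iter n markov_shift) (measurable_iter_markov_shift n).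

Lemma measurable_dilation_past A n : (forall i, measurable (A i)) ->
  measurable (dilation_past A n).
Proof.
move=> mA; have mY : measurable_fun setT
    (fun z => (fun i => (iter i markov_shift z).1 : cantor) : seqspace cantor).
  apply: measurable_to_seqspace => i.
  exact: (measurableT_comp measurable_fst (measurable_iter_markov_shift i)).
have := mY measurableT _ (measurable_cylinder n mA); rewrite setTI; apply.
Qed.

(** The noise left after [n] steps is fresh. The induction hypothesis speaks of rectangles, and
    uniqueness of product measures extends it to the set from which the next shift lands in a
    rectangle. *)
Lemma dilation_past_rectangle n A B C (mA : forall i, measurable (A i)) :
  measurable B -> measurable C ->
  dilation (dilation_past A n `&` iter n markov_shift @^-1` (B `*` C)) =
  (mu (past A n `&` Y n @^-1` B) * @coin R C)%E.
Proof.
elim: n B C => [|n IH] B C mB mC.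
  have -> : dilation_past A 0 = setT by apply/seteqP; split.
  have -> : past A 0 = setT by apply/seteqP; split.
  by rewrite !setTI /dilation product_measure1E.
rewrite Y_markov// -markov_shift_rectangle//.
have -> : dilation_past A n.+1 `&` iter n.+1 markov_shift @^-1` (B `*` C) =
    dilation_past A n `&` iter n markov_shift @^-1`
      ((A n `*` setT) `&` markov_shift @^-1` (B `*` C)).
  apply/seteqP; split => z /= [zA zBC].
    by split; [move=> i il; apply: zA; exact: ltnW|split => //; split => //; exact: zA].
  move: zBC => [[An _] ?]; split => // i; rewrite ltnS leq_eqVlt => /predU1P[->//|].
  exact: zA.
pose m' := restricted_law [the probability _ _ of dilation] (measurable_dilation_past n mA)
  (iter n markov_shift).
transitivity (m' ((A n `*` setT) `&` markov_shift @^-1` (B `*` C))).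
  exact/esym/restricted_lawE.
apply/esym/product_measure_unique.
  move=> A' B' mA' mB'; transitivity (dilation (dilation_past A n `&`
    iter n markov_shift @^-1` (A' `*` B'))); first exact: restricted_lawE.
  by rewrite IH//; congr (_ * _)%E; exact/esym/restricted_lawE.
apply: measurableI; first exact: measurableX.
by apply: (measurable_funPTI markov_shift); exact: measurableX.
Qed.

Lemma dilation_pastE n A : (forall i, measurable (A i)) ->
  dilation (dilation_past A n) = mu (past A n).
Proof.
move=> mA; have := dilation_past_rectangle n mA measurableT measurableT.
by rewrite setXTT !preimage_setT !setIT probability_setT mule1.
Qed.

Lemma dilation_map_preserving k : measure_preserving dilation (dilation_map k).
Proof.
move=> D mD; pose m' := distribution [the probability _ _ of dilation] (dilation_map k).
apply/esym; rewrite -[RHS]/(m' D); apply: product_measure_unique => // A B mA mB.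
rewrite /m' /distribution /pushforward; case: k {m'} => [|k].
  (* One step with an unconstrained past gives the law of [Y 1] times [coin], and stationarity turns
     [Y 1] into [Y 0]. *)
  pose A' (i : nat) : set cantor := setT.
  have mA' i : measurable (A' i) by exact: measurableT.
  have := dilation_past_rectangle 1 mA' mA mB.
  have -> : dilation_past A' 1 = setT by apply/seteqP; split.
  have -> : past A' 1 = setT by apply/seteqP; split.
  by rewrite !setTI Y_stat//; apply.
transitivity (dilation (A `*` (delete_row enc dec k.+1 @^-1` B))) => //.
rewrite /dilation product_measure1E//; last first.
  exact: (measurable_funPTI (delete_row enc dec k.+1)).
by congr (_ * _)%E; exact: (coin_delete_row encK decK).
Qed.

End markov_dilation.

(** * Coding a standard Borel space in Cantor space *)

Lemma exists_nat_pairing :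
  exists (enc : nat * nat -> nat) (dec : nat -> nat * nat), cancel enc dec /\ cancel dec enc.
Proof.
have /card_set_bijP[enc] := card_nat2.
by rewrite setTT_bijective => -[dec encK decK]; exists enc, dec.
Qed.

Section polish_coding.
Context {R : realType} (X : metricType R) (x0 : X) (dn : nat -> X).
Hypothesis complete_X : forall F : set_system X, ProperFilter F -> cauchy F ->
  exists x : X, F --> x.
Hypothesis dense_dn : forall x e, 0 < e -> exists n, mdist (dn n) x < e.
Variables (enc : nat * nat -> nat) (dec : nat -> nat * nat).
Hypothesis encK : cancel enc dec.

(** A point is determined by which points of a dense sequence lie within which dyadic distance of
    it. *)
Definition polish_code (x : X) : cantor :=
  fun n => mdist (dn (dec n).2) x < 2^-1 ^+ (dec n).1.

(* The first point of [dn] recorded at precision [2^-k]; the default [0] only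
   occurs on sequences that are not codes. *)
Definition first_index (c : cantor) k : nat :=
  if pselect (exists j, c (enc (k, j))) is left h then ex_minn h else 0%N.

(** The inequality is not strict, so it survives the limit in [exists_coded_pointP]. *)
Definition coded_point (c : cantor) (x : X) : Prop :=
  forall k, mdist (dn (first_index c k)) x <= 2^-1 ^+ k.

Definition polish_decode (c : cantor) : X := xget x0 [set x | coded_point c x].

Let half_gt0 n : 0 < 2^-1 ^+ n :> R.
Proof. by rewrite exprn_gt0// invr_gt0. Qed.

Let small_eq0 (a : R) : 0 <= a -> (forall k, a <= 2^-1 ^+ k + 2^-1 ^+ k) -> a = 0.
Proof.
move=> a0 ak; apply/eqP; rewrite eq_le a0 andbT leNgt; apply/negP => agt0.
have [n] : exists n, 2^-1 ^+ n < a / 2 by apply: exists_half_expr; rewrite divr_gt0.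
by have := ak n; lra.
Qed.

Lemma coded_point_unique c x y : coded_point c x -> coded_point c y -> x = y.
Proof.
move=> cx cy; apply: mdist_positivity; apply: small_eq0; first exact: mdist_ge0.
move=> k; apply: le_trans (metric_triangle x (dn (first_index c k)) y) _.
by apply: lerD => //; rewrite metric_sym.
Qed.

Lemma coded_point_code x : coded_point (polish_code x) x.
Proof.
move=> k; rewrite /first_index; case: pselect => [h|[]].
  by case: ex_minnP => j + _; rewrite /polish_code encK /= => /ltW.
by have [j jx] := dense_dn x (half_gt0 k); exists j; rewrite /polish_code encK.
Qed.

Lemma polish_codeK : cancel polish_code polish_decode.
Proof.
move=> x; apply: (@coded_point_unique (polish_code x)); last exact: coded_point_code.
by apply: (@xgetPex _ x0 [set y | coded_point (polish_code x) y]); exists x;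
  exact: coded_point_code.
Qed.

(** Completeness replaces the existence of a point by countably many conditions on indices, which
    makes the set of decodable sequences measurable. *)
Lemma exists_coded_pointP c : (exists x, coded_point c x) <->
  (forall k l, mdist (dn (first_index c k)) (dn (first_index c l)) <= 2^-1 ^+ k + 2^-1 ^+ l).
Proof.
split=> [[x cx] k l|c_cauchy].
  apply: le_trans (metric_triangle _ x _) _.
  by apply: lerD => //; rewrite metric_sym.
pose u n := dn (first_index c n).
have [x ux] : exists x : X, u n @[n --> \oo] --> x.
  apply: complete_X; apply: cauchy_exP => e e0.
  have [N Ne] : exists n, 2^-1 ^+ n < e / 2 by apply: exists_half_expr; rewrite divr_gt0.
  exists (u N); exists N => // n /= Nn; rewrite /ball_ ballEmdist /=.
  apply: le_lt_trans (c_cauchy N n) _.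
  have : 2^-1 ^+ n <= 2^-1 ^+ N :> R by rewrite half_exprP.
  by move: Ne; lra.
exists x => k; apply/ler_addgt0Pr => e e0.
have [N Ne] : exists n, 2^-1 ^+ n < e / 2 by apply: exists_half_expr; rewrite divr_gt0.
have e20 : 0 < e / 2 by rewrite divr_gt0.
have [M _ Mx] := (cvg_ballP _ _).1 ux _ e20.
have := Mx (maxn M N) (leq_maxl _ _); rewrite /= ballEmdist /= metric_sym => ux'.
apply: le_trans (metric_triangle _ (u (maxn M N)) _) _.
have := c_cauchy k (maxn M N); rewrite -/(u _).
have : 2^-1 ^+ (maxn M N) <= 2^-1 ^+ N :> R by rewrite half_exprP leq_maxr.
rewrite /u in ux' *; move: Ne ux'; lra.
Qed.

Let measurable_bit n : measurable [set c : cantor | c n].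
Proof.
by have := @measurable_coord _ bool n measurableT [set true]; rewrite setTI; apply.
Qed.

Let measurable_first_index k j : measurable [set c | first_index c k = j].
Proof.
pose B i := [set c : cantor | c (enc (k, i))].
have mB i : measurable (B i) by exact: measurable_bit.
(* The last set stems from the default index: it holds the sequences with no bit set at precision
   [k]. *)
rewrite (_ : [set c | _] =
    (B j `&` \bigcap_(i in [set i | (i < j)%N]) ~` B i) `|`
    (if j == 0%N then \bigcap_i ~` B i else set0)).
  apply: measurableU.
    by apply: measurableI => //; apply: bigcap_measurableType => i _; exact: measurableC.
  by case: ifP => // _; apply: bigcap_measurableType => i _; exact: measurableC.
apply/seteqP; split => c; rewrite /first_index /=.
  case: pselect => [h|nh].
    case: ex_minnP => i ci imin <-; left; split => // l /= li cl.
    by have := imin _ cl; rewrite leqNgt li.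
  by move=> <-; right; rewrite eqxx => i _ ci; apply: nh; exists i.
case: pselect => [h|nh] [].
- move=> [cj jmin]; case: ex_minnP => i ci imin; apply/eqP.
  rewrite eqn_leq imin// leqNgt; apply/negP => ij; exact: jmin ij ci.
- by case: ifP => // _ nc; case: (h) => i ci; case: (nc i).
- by move=> [cj _]; case: nh; exists j.
- by case: ifP => // /eqP.
Qed.

Let measurable_first_index2 (S : nat -> nat -> Prop) k l :
  measurable [set c | S (first_index c k) (first_index c l)].
Proof.
rewrite (_ : [set c | _] = \bigcup_i \bigcup_j (if pselect (S i j) then
    [set c | first_index c k = i] `&` [set c | first_index c l = j] else set0)).
  apply: bigcupT_measurable => i; apply: bigcupT_measurable => j.
  by case: pselect => /= _ //; apply: measurableI; exact: measurable_first_index.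
apply/seteqP; split => c /=.
  by move=> Sc; exists (first_index c k) => //; exists (first_index c l) => //; case: pselect.
by move=> [i _ [j _]]; case: pselect => //= ? [-> ->].
Qed.

Let measurable_coded : measurable [set c | exists x, coded_point c x].
Proof.
rewrite (_ : [set c | _] = \bigcap_k \bigcap_l
  [set c | mdist (dn (first_index c k)) (dn (first_index c l)) <= 2^-1 ^+ k + 2^-1 ^+ l]).
  apply: bigcap_measurableType => k _; apply: bigcap_measurableType => l _.
  exact: (measurable_first_index2 (fun i j => mdist (dn i) (dn j) <= 2^-1 ^+ k + 2^-1 ^+ l)).
by apply/seteqP; split => c /=; rewrite exists_coded_pointP => h k; [move=> _ l _|move=> l];
  apply: h.
Qed.

Lemma measurable_polish_decode_open U : open U -> measurable (polish_decode @^-1` U).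
Proof.
move=> oU; pose G := [set c | exists x, coded_point c x].
have decodeP c : G c -> coded_point c (polish_decode c).
  by move=> Gc; apply: (@xgetPex _ x0 [set y | coded_point c y]).
(* A decodable [c] goes into [U] exactly when, for some [k], the closed ball of radius 2^-k around
   its recorded point lies in [U], a condition on a single index; all other sequences go to [x0]. *)
rewrite (_ : _ @^-1` _ =
    (G `&` \bigcup_k [set c | forall x, mdist (dn (first_index c k)) x <= 2^-1 ^+ k -> U x])
    `|` (if pselect (U x0) then ~` G else set0)).
  apply: measurableU.
    apply: measurableI => //; apply: bigcupT_measurable => k.
    exact: (measurable_first_index2
      (fun i _ => forall x, mdist (dn i) x <= 2^-1 ^+ k -> U x) k k).
  by case: pselect => /= _ //; exact: measurableC.
apply/seteqP; split => c /=.
  move=> Uc; have [Gc|nGc] := pselect (G c); [left|right].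
    split => //; move: oU; rewrite openE => /(_ _ Uc) /nbhs_ballP[e /= e0 eU].
    have [N Ne] : exists n, 2^-1 ^+ n < e / 2 by apply: exists_half_expr; rewrite divr_gt0.
    exists N => // x /= dx; apply: eU; rewrite ballEmdist /=.
    apply: le_lt_trans (metric_triangle _ (dn (first_index c N)) _) _.
    by have := decodeP _ Gc N; rewrite metric_sym; move: dx Ne; lra.
  case: pselect => // nU; apply: nU; move: Uc; rewrite /preimage /= /polish_decode.
  by rewrite xgetPN// => x cx; apply: nGc; exists x.
move=> [[Gc [k _ kU]]|]; first by apply: kU; exact: decodeP.
case: pselect => // Ux0 nGc; rewrite /preimage /= /polish_decode xgetPN//.
by move=> x cx; apply: nGc; exists x.
Qed.

Lemma measurable_polish_decode U : <<s [set U | open U] >> U ->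
  measurable (polish_decode @^-1` U).
Proof.
suff : <<s [set U | open U] >> `<=` [set U | measurable (polish_decode @^-1` U)] by apply.
apply: smallest_sub; last by move=> V; exact: measurable_polish_decode_open.
split => /=.
- by rewrite preimage_set0.
- by move=> A mA; rewrite setTD preimage_setC; exact: measurableC.
- by move=> A mA; rewrite preimage_bigcup; exact: bigcupT_measurable.
Qed.

End polish_coding.

(** A retraction, unlike an isomorphism, exists for countable spaces as well, and the range of the
    code need not be described. *)
Lemma standard_borel_retract (R : realType) d (T : measurableType d) :
  standard_borel R T ->
  exists (phi : {mfun T >-> cantor}) (psi : {mfun cantor >-> T}), cancel phi psi.
Proof.
move=> [X [h [cX [D cD dD] [hi hK hiK] mT]]].
have [enc [dec [encK _]]] := exists_nat_pairing.
pose x0 := h point.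
have /countable_injP[f finj] := cD.
(* An index that [f] does not attain on [D] yields the default [x0]; density only asks that each
   point of [D] occurs somewhere. *)
pose dn n := xget x0 [set x | D x /\ f x = n].
have dense_dn x e : 0 < e -> exists n, mdist (dn n) x < e.
  move=> e0; have [y [xy Dy]] : (ball x e)° `&` D !=set0.
    apply: dD; last exact: open_interior.
    by exists x; exact: nbhsx_ballx.
  exists (f y); rewrite /dn; case: xgetP => [z _ [Dz fz]|/(_ y)]; last by case.
  have -> : z = y by apply: finj => //; rewrite inE.
  by rewrite metric_sym; move/interior_subset: xy; rewrite ballEmdist.
have mh U : open U -> measurable (h @^-1` U).
  move=> oU; rewrite mT; exists U; last by rewrite setTI.
  exact: sub_sigma_algebra.
have mphi : measurable_fun setT (fun x => polish_code dn dec (h x)).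
  apply: measurable_to_seqspace => n; apply: (@measurable_fun_bool _ _ _ _ true).
  pose p := dn (dec n).2; pose r := 2^-1 ^+ (dec n).1 : R.
  rewrite setTI (_ : _ @^-1` _ = h @^-1` ball p r).
    apply: mh; rewrite openE => y; rewrite ballEmdist /= => py; apply/nbhs_ballP.
    exists (r - mdist p y); first by rewrite /= subr_gt0.
    move=> z; rewrite !ballEmdist /= => yz.
    by apply: le_lt_trans (metric_triangle p y z) _; move: yz; lra.
  by rewrite ballEmdist; apply/seteqP; split => x /=.
have mpsi : measurable_fun setT (fun c => hi (polish_decode x0 dn enc c)).
  move=> _ B; rewrite setTI mT => -[U mU <-]; rewrite setTI.
  rewrite (_ : _ @^-1` _ = polish_decode x0 dn enc @^-1` U).
    exact: measurable_polish_decode.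
  by apply/seteqP; split => c; rewrite /preimage /= hiK.
pose phi : {mfun T >-> cantor} := HB.pack (fun x => polish_code dn dec (h x))
  (isMeasurableFun.Build _ _ _ _ _ mphi).
pose psi : {mfun cantor >-> T} := HB.pack (fun c => hi (polish_decode x0 dn enc c))
  (isMeasurableFun.Build _ _ _ _ _ mpsi).
exists phi, psi => x; rewrite /phi /psi /=.
by rewrite polish_codeK.
Qed.

(** * Conditional expectations *)

Lemma bounded_Lfun_pinfty d (T : measurableType d) (R : realType)
    (mu : probability T R) (f : T -> R) (M : R) :
  measurable_fun setT f -> (forall x, `|f x| <= M) -> f \in Lfun mu +oo.
Proof.
move=> mf fM; rewrite inE; apply/andP; split; first by rewrite inE.
rewrite inE /= /finite_norm unlock /Lnorm; case: ifP => // _.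
apply: (@le_lt_trans _ _ M%:E); last exact: ltry.
by apply/ess_supP; apply: nearW => x /=; rewrite lee_fin.
Qed.

Lemma integral_restricted_law d (T : measurableType d) d' (T' : measurableType d')
    (R : realType) (mu : {finite_measure set T -> \bar R}) D (mD : measurable D)
    (f : {mfun T >-> T'}) (h : T' -> \bar R) A :
  measurable A -> measurable_fun setT h -> (forall y, (0 <= h y)%E) ->
  (\int[restricted_law mu mD f]_(y in A) h y =
   \int[mu]_(x in D `&` f @^-1` A) h (f x))%E.
Proof.
move=> mA mh h0; have mfA := measurable_funPTI f mA.
rewrite /restricted_law ge0_integral_pushforward//; last exact: measurable_funTS.
have mhf : measurable_fun setT (h \o f) by exact: measurableT_comp.
rewrite (@ge0_negligible_integral _ _ _ (mrestr mu mD) (f @^-1` A) (~` D))//.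
- rewrite setDE setCK setIC; apply: eq_measure_integral => B mB BD.
  by rewrite /= /mrestr setIidl// => x /BD[].
- exact: measurableC.
- exact: measurable_funTS.
- by move=> x _; exact: h0.
- by rewrite /= /mrestr setICl measure0.
Qed.

Section cond_exp_theory.
Context d (T : measurableType d) (R : realType) (mu : probability T R).
Variable S : set_system T.
Hypothesis mS : <<s S >> `<=` @measurable _ T.

Lemma Lfun_pinfty_integrable (f : T -> R) A : f \in Lfun mu +oo -> measurable A ->
  mu.-integrable A (EFin \o f).
Proof.
move=> fL mA; have : f \in Lfun mu 1.
  by apply: (Lfun_subset _ _ _ _ fL) => //; [exact: leey|exact: fin_num_measure|exact: leey].
by move=> /Lfun1_integrable; exact: integrableS.
Qed.

(** Both versions are measurable for the coarse sigma-algebra; on the space that carries it, with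
    the image of [mu] under the identity, equal integrals over all measurable sets force equality
    almost everywhere. *)
Lemma is_cond_exp_ae_unique f g1 g2 :
  is_cond_exp mu <<s S >> f g1 -> is_cond_exp mu <<s S >> f g2 -> g1 = g2 %[ae mu].
Proof.
move=> [L1 m1 i1] [L2 m2 i2].
pose TS := g_sigma_algebraType S.
have mid : measurable_fun setT (id : T -> TS).
  by move=> _ B mB; rewrite setTI; exact: mS.
pose idS : {mfun T >-> TS} := HB.pack (id : T -> TS) (isMeasurableFun.Build _ _ _ _ _ mid).
pose nu := distribution mu idS.
have mTS (g : T -> R) : (forall B, measurable B -> <<s S >> (g @^-1` B)) ->
    measurable_fun setT (EFin \o (g : TS -> R)).
  by move=> mg; apply/measurable_EFinP => _ B mB; rewrite setTI; exact: mg.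
have iTS g A : g \in Lfun mu +oo -> (forall B, measurable B -> <<s S >> (g @^-1` B)) ->
    <<s S >> A -> (\int[nu]_(x in A) (g x)%:E = \int[mu]_(x in A) (g x)%:E)%E.
  move=> gL mg SA; rewrite /nu /distribution integral_pushforward//; first exact: mTS.
  by apply: Lfun_pinfty_integrable => //; exact: mS.
have int1 : nu.-integrable setT (EFin \o (g1 : TS -> R)).
  exact: (integrable_pushforward mid (mTS _ m1)
    (Lfun_pinfty_integrable L1 measurableT) measurableT).
have := @integral_ae_eq _ TS R nu setT measurableT _ _ int1 (mTS _ m2) _.
have h E : E `<=` setT -> measurable E -> (\int[nu]_(x in E) (EFin \o g1) x =
    \int[nu]_(x in E) (EFin \o g2) x)%E.
  by move=> _ mE; rewrite !iTS// i1// i2.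
move=> /(_ h) [N [mN N0 sub]]; exists N; split => //; first exact: mS.
move=> x /= g12; apply: sub => /= /(_ I) -[e]; apply: g12 => _; exact: e.
Qed.

Lemma cond_exp_ae_unique f g : is_cond_exp mu <<s S >> f g ->
  cond_exp mu <<s S >> f = g %[ae mu].
Proof.
move=> fg; apply: (@is_cond_exp_ae_unique f) => //.
by apply: (@xgetPex _ (cst 0) [set g | is_cond_exp mu <<s S >> f g]); exists g.
Qed.

End cond_exp_theory.

(** * The Markov property *)

Section sigma_rv_theory.
Context d (T : measurableType d) d0 (T0 : measurableType d0) (R : realType).
Variables (mu : probability T R) (xi : nat -> {RV mu >-> T0}).

Definition sigma_rv_gen (I : set nat) : set_system T :=
  (\bigcup_(i in I) preimage_set_system setT (xi i) measurable) `|`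
  [set N | measurable N /\ mu N = 0%E].

Lemma sigma_rvE I : sigma_rv xi I = <<s sigma_rv_gen I >>.
Proof. by []. Qed.

Lemma sigma_rv_gen_measurable I : sigma_rv_gen I `<=` measurable.
Proof.
move=> A [[i _ [B mB <-]]|[]//]; rewrite setTI.
exact: (measurable_funPTI (xi i)).
Qed.

Lemma sigma_rv_measurable I : sigma_rv xi I `<=` measurable.
Proof.
apply: smallest_sub; first exact: sigma_algebra_measurable.
exact: sigma_rv_gen_measurable.
Qed.

Lemma sigma_rv_preimage (I : set nat) i B :
  I i -> measurable B -> sigma_rv xi I (xi i @^-1` B).
Proof.
by move=> Ii mB; apply: sub_sigma_algebra; left; exists i => //; exists B; rewrite ?setTI.
Qed.

(** Completion puts the null sets among the generators; domination by [mu] makes both measures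
    vanish there. *)
Lemma sigma_rv_singleton_unique (m1 m2 : {finite_measure set T -> \bar R}) n :
  (forall B, measurable B -> m1 (xi n @^-1` B) = m2 (xi n @^-1` B)) ->
  m1 `<< mu -> m2 `<< mu ->
  forall D, sigma_rv xi [set n] D -> m1 D = m2 D.
Proof.
move=> m12 m1mu m2mu.
have null (m : {finite_measure set T -> \bar R}) N :
    m `<< mu -> measurable N -> mu N = 0%E -> m N = 0%E.
  by move=> /null_content_dominatesP mmu mN N0; exact: mmu.
(* The preimages together with the null sets are stable under intersection. *)
rewrite sigma_rvE; apply: (g_sigma_algebra_measure_unique _ _ (fun=> setT)).
- exact: sigma_rv_gen_measurable.
- by move=> _; left; exists n => //; exists setT; rewrite ?setTI ?preimage_setT.
- by rewrite bigcup_const.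
- move=> A B GA GB.
  have [mA mB] := (sigma_rv_gen_measurable GA, sigma_rv_gen_measurable GB).
  have mAB := measurableI _ _ mA mB.
  case: GA => [[_ -> [A' mA' EA]]|[_ A0]]; last first.
    right; split => //; apply/eqP; rewrite -measure_le0 -[leRHS]A0.
    by apply: le_measure; rewrite ?inE.
  case: GB => [[_ -> [B' mB' EB]]|[_ B0]]; last first.
    right; split => //; apply/eqP; rewrite -measure_le0 -[leRHS]B0.
    by apply: le_measure; rewrite ?inE.
  left; exists n => //; exists (A' `&` B'); first exact: measurableI.
  by rewrite -EA -EB !setTI preimage_setI.
- move=> A [[_ -> [A' mA' <-]]|[mA A0]]; first by rewrite setTI; exact: m12.
  by transitivity (0 : \bar R)%E; [exact: null|exact/esym/null].
- by move=> _; rewrite -ge0_fin_numE; [exact: fin_num_measure|exact: measure_ge0].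
Qed.

End sigma_rv_theory.

(** * Transition probabilities of the coded chain *)

Section markov_transition.
Context d (T : measurableType d) d0 (T0 : measurableType d0) (R : realType).
Variables (mu : probability T R) (xi : nat -> {RV mu >-> T0}).
Hypotheses (stat : stationary_sequence xi) (markov : markov_sequence xi).
Variables (phi : {mfun T0 >-> cantor}) (psi : {mfun cantor >-> T0}).
Hypothesis phiK : cancel phi psi.

Let Y n : {mfun T >-> cantor} := phi \o xi n.

Variable g : {mfun (cantor * cantor)%type >-> cantor}.
Hypothesis g_kernel : forall A B, measurable A -> measurable B ->
  (\int[distribution mu (Y 0)]_(y in A) @coin R [set c | B (g (y, c))] =
   mu (Y 0 @^-1` A `&` Y 1 @^-1` B))%E.

Lemma stationary_pair n A B : measurable A -> measurable B ->
  mu (Y n @^-1` A `&` Y n.+1 @^-1` B) = mu (Y 0%N @^-1` A `&` Y 1%N @^-1` B).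
Proof.
case: n => // n mA mB.
pose C i := if i == 0%N then phi @^-1` A else phi @^-1` B.
have mC i : measurable (C i) by rewrite /C; case: ifP => _; exact: measurable_funPTI.
have := stat (n := n.+1) isT (measurable_cylinder 2 mC).
set P := [set w | _] => PE.
have -> : Y n.+1 @^-1` A `&` Y n.+2 @^-1` B = (fun x k => xi (n.+1 + k)%N x) @^-1` P.
  apply/seteqP; split => x; rewrite /P /preimage /= .
    by move=> [? ?] [|[|//]] _; rewrite /C /= ?addn0 ?addn1.
  by move=> h; split; [have := h 0%N isT|have := h 1%N isT]; rewrite /C /= ?addn0 ?addn1.
rewrite -PE; congr (mu _); apply/seteqP; split => x; rewrite /P /preimage /=.
  by move=> h; split; [have := h 0%N isT|have := h 1%N isT]; rewrite /C.
by move=> [? ?] [|[|//]] _; rewrite /C.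
Qed.

Lemma stationary_single n A : measurable A -> mu (Y n @^-1` A) = mu (Y 0%N @^-1` A).
Proof.
move=> mA; have := stationary_pair n mA measurableT.
by rewrite !preimage_setT !setIT.
Qed.

Let kappa B y := @coin R [set c | B (g (y, c))].

Let measurable_section B y : measurable B -> measurable [set c | B (g (y, c))].
Proof.
move=> mB; have mgy : measurable_fun setT (fun c => g (y, c)).
  by apply: measurableT_comp => //; exact: measurable_fun_pair.
by have := mgy measurableT B mB; rewrite setTI.
Qed.

Let measurable_kappa B : measurable B -> measurable_fun setT (kappa B).
Proof. exact: (@measurable_graph_section _ cantor _ cantor _ cantor R (@coin R) g). Qed.

Let kappa_fin B y : measurable B -> (fine (kappa B y))%:E = kappa B y.
Proof. by move=> mB; rewrite fineK// fin_num_measure//; exact: measurable_section. Qed.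

(** Both sides are finite measures in [D] dominated by [mu]; on preimages under [xi n], stationarity
    moves the identity to time 0, where it is [g_kernel]. *)
Lemma transition_integral n B D : measurable B -> sigma_rv xi [set n] D ->
  (\int[mu]_(x in D) kappa B (Y n x) = mu (D `&` Y n.+1 @^-1` B))%E.
Proof.
move=> mB GD.
pose G (z : T * cantor) := g (Y n z.1, z.2).
have mG : measurable_fun setT G.
  apply: measurableT_comp => //; apply: measurable_fun_pair => //.
  by apply: measurableT_comp => //; exact: measurable_fst.
pose P := [the probability _ R of (mu \x @coin R)%E].
have mE : measurable (G @^-1` B) by have := mG measurableT B mB; rewrite setTI.
pose fstf : {mfun (T * cantor)%type >-> T} := HB.pack (fst : T * cantor -> T)
   (isMeasurableFun.Build _ _ _ _ _ measurable_fst).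
pose idf : {mfun T >-> T} := HB.pack (id : T -> T)
   (isMeasurableFun.Build _ _ _ _ _ (@measurable_id _ T setT)).
have [m1 m1E] : exists m1 : {finite_measure set T -> \bar R},
    forall A, m1 A = (\int[mu]_(x in A) kappa B (Y n x))%E.
  (* The integral is the mass, under the product of [mu] and [coin], of the part above [A] of the
     event that [G] lies in [B]; hence it is a finite measure in [A]. *)
  exists (restricted_law P mE fstf) => A.
  rewrite -[RHS](product_measure_graphE mu (@coin R) G).
  transitivity (P (G @^-1` B `&` fstf @^-1` A)); first exact: restricted_lawE.
  rewrite setIC /P /=; congr product_measure1; apply/seteqP; split => z /=.
    by move=> [? ?].
  by move=> [[? _] ?].
have [m2 m2E] : exists m2 : {finite_measure set T -> \bar R},
    forall A, m2 A = mu (A `&` Y n.+1 @^-1` B).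
  exists (restricted_law mu (measurable_funPTI (Y n.+1) mB) idf) => A.
  by rewrite setIC; exact: restricted_lawE.
have mkY : measurable_fun setT (kappa B \o Y n).
  by apply: measurableT_comp; [exact: measurable_kappa|].
rewrite -m1E -m2E; apply: (sigma_rv_singleton_unique (xi := xi) (n := n)) => //.
- move=> C mC; rewrite m1E m2E.
  (* As [psi] undoes [phi], events of [xi n] are events of [Y n]. *)
  have -> : xi n @^-1` C = Y n @^-1` (psi @^-1` C).
    by apply/seteqP; split => x; rewrite /preimage /= phiK.
  have mC' : measurable (psi @^-1` C) by exact: measurable_funPTI.
  rewrite stationary_pair// -g_kernel//.
  transitivity (\int[distribution mu (Y n)]_(y in psi @^-1` C) kappa B y)%E.
    rewrite /distribution ge0_integral_pushforward//.
    exact: measurable_funTS (measurable_kappa mB).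
  apply: eq_measure_integral => A mA _.
  exact: stationary_single.
- apply/null_content_dominatesP => A mA A0.
  by rewrite m1E null_set_integral//; exact: measurable_funTS.
- apply/null_content_dominatesP => A mA A0; apply/eqP.
  rewrite m2E -measure_le0 -[leRHS]A0; apply: le_measure; rewrite ?inE//.
  by apply: measurableI => //; exact: measurable_funPTI.
Qed.

(** The Markov property is applied to the indicator of the event that [Y n.+1] lies in [B]. The
    inner conditional expectation does not change it almost everywhere, and by [transition_integral]
    the one given [xi n] is [kappa B] at [Y n]. *)
Lemma markov_transition_set n B D : measurable B ->
  sigma_rv xi [set i | (i <= n)%N] D ->
  (\int[mu]_(x in D) kappa B (Y n x) = mu (D `&` Y n.+1 @^-1` B))%E.
Proof.
move=> mB GD.
have mYB : measurable (Y n.+1 @^-1` B) by exact: measurable_funPTI.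
have mD := sigma_rv_measurable GD.
pose F : T -> R := \1_(Y n.+1 @^-1` B).
have mF : measurable_fun setT F by exact: measurable_indic.
have FL : F \in Lfun mu +oo.
  apply: (@bounded_Lfun_pinfty _ _ _ mu F 1) => // x.
  by rewrite /F indicE; case: (_ \in _); rewrite ?normr1 ?normr0.
have intF A : measurable A -> (\int[mu]_(x in A) (F x)%:E = mu (A `&` Y n.+1 @^-1` B))%E.
  by move=> mA; rewrite integral_indic// setIC.
pose f1 := cond_exp mu (sigma_rv xi [set n.+1]) F.
have F_cond : is_cond_exp mu (sigma_rv xi [set n.+1]) F F.
  split => // C mC.
  rewrite (_ : F @^-1` C = xi n.+1 @^-1` ((\1_(phi @^-1` B) : T0 -> R) @^-1` C)).
    apply: sigma_rv_preimage => //.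
    rewrite -[X in measurable X]setTI; apply: measurable_indic => //.
    exact: measurable_funPTI.
  by apply/seteqP; split.
have [f1L mf1 _] : is_cond_exp mu (sigma_rv xi [set n.+1]) F f1.
  by apply: (@xgetPex _ (cst 0)
    [set h | is_cond_exp mu (sigma_rv xi [set n.+1]) F h]); exists F.
have f1F : f1 = F %[ae mu].
  exact: (cond_exp_ae_unique (@sigma_rv_measurable _ _ _ _ _ mu xi [set n.+1])).
have int1 A : measurable A -> (\int[mu]_(x in A) (f1 x)%:E = mu (A `&` Y n.+1 @^-1` B))%E.
  move=> mA; rewrite -intF//; apply: ae_eq_integral => //.
  - by apply: measurable_int; exact: Lfun_pinfty_integrable f1L mA.
  - by apply/measurable_EFinP; exact: measurable_funTS.
  - by apply: filterS f1F => x e _; rewrite /= e.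
pose h z := fine (kappa B (phi z)).
have mh : measurable_fun setT h.
  apply: (measurableT_comp (fine_measurable _)) => //.
  by apply: measurableT_comp => //; exact: measurable_kappa.
pose hk x := h (xi n x).
have hkE x : (hk x)%:E = kappa B (Y n x) by exact: kappa_fin.
have hk_cond : is_cond_exp mu (sigma_rv xi [set n]) f1 hk.
  split.
  - apply: (@bounded_Lfun_pinfty _ _ _ mu hk 1); first exact: measurableT_comp.
    move=> x; rewrite ger0_norm; last exact: fine_ge0 (measure_ge0 _ _).
    rewrite -lee_fin hkE.
    by apply: probability_le1; exact: measurable_section.
  - move=> C mC; apply: (@sigma_rv_preimage _ _ _ _ _ _ _ _ n (h @^-1` C)) => //.
    by rewrite -[X in measurable X]setTI; exact: mh.
  - move=> A GA; rewrite int1; last exact: sigma_rv_measurable GA.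
    by rewrite -transition_integral//; apply: eq_integral => x _.
pose f2 := cond_exp mu (sigma_rv xi [set n]) f1.
have f2hk : f2 = hk %[ae mu].
  exact: (cond_exp_ae_unique (@sigma_rv_measurable _ _ _ _ _ mu xi [set n])).
pose f3 := cond_exp mu (sigma_rv xi [set i | (i <= n)%N]) f1.
have f3hk : f3 = hk %[ae mu].
  apply: filterS2 (markov n FL) f2hk => x e1 e2 _; rewrite /f3 (e1 I); exact: e2.
have mhk A : measurable A -> measurable_fun A (fun x => kappa B (Y n x)).
  move=> _; apply: measurable_funTS; apply: measurableT_comp => //.
  exact: measurable_kappa.
have [[f' f'_cond]|no_version] :=
    pselect (exists f', is_cond_exp mu (sigma_rv xi [set i | (i <= n)%N]) f1 f').
  have [f3L _ f3_int] : is_cond_exp mu (sigma_rv xi [set i | (i <= n)%N]) f1 f3.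
    by apply: (@xgetPex _ (cst 0)
      [set h | is_cond_exp mu (sigma_rv xi [set i | (i <= n)%N]) f1 h]); exists f'.
  rewrite -int1// -f3_int//; apply: ae_eq_integral => //.
  - exact: mhk.
  - by apply: measurable_int; exact: Lfun_pinfty_integrable f3L mD.
  - by apply: filterS f3hk => x e _; rewrite -hkE -e.
(* [cond_exp] is then its default value [0], so the Markov property makes
   [kappa B (Y n _)] vanish almost everywhere: both sides are [0]. *)
have f30 : f3 = cst 0 by apply: xgetPN => f' f'_cond; apply: no_version; exists f'.
have kappa0 A : measurable A -> (\int[mu]_(x in A) kappa B (Y n x) = 0)%E.
  move=> mA; rewrite -(integral0 mu A); apply: ae_eq_integral => //.
  - exact: mhk.
  - by apply: filterS f3hk => x e _; rewrite -hkE -e// f30.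
rewrite kappa0//; apply/esym/eqP; rewrite -measure_le0.
rewrite -[leRHS](kappa0 setT measurableT) (@transition_integral n B setT)//; last first.
  by rewrite -(preimage_setT (xi n)); exact: sigma_rv_preimage.
apply: le_measure; rewrite ?inE//; first exact: measurableI.
  exact: measurableI.
exact: setSI.
Qed.

Lemma markov_transition n A B (mA : forall i, measurable (A i)) : measurable B ->
  mu (past Y A n.+1 `&` Y n.+1 @^-1` B) =
  (\int[restricted_law mu (measurable_past Y n mA) (Y n)]_(y in A n) kappa B y)%E.
Proof.
move=> mB; rewrite integral_restricted_law//; last exact: measurable_kappa.
have -> : past Y A n `&` Y n @^-1` A n = past Y A n.+1.
  apply/seteqP; split => x /=.
    by move=> [xA xAn] i; rewrite ltnS leq_eqVlt => /predU1P[->//|]; exact: xA.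
  by move=> xA; split; [move=> i il; apply: xA; exact: ltnW|exact: xA].
rewrite markov_transition_set//.
pose S := sigma_rv_gen xi [set i | (i <= n)%N].
rewrite (_ : past Y A n.+1 =
    \bigcap_(i in [set i | (i <= n)%N]) xi i @^-1` (phi @^-1` A i)).
  apply: (@bigcap_measurableType _ (g_sigma_algebraType S)) => i /= il.
  by apply: (@sigma_rv_preimage _ _ _ _ _ mu xi) => //; exact: measurable_funPTI.
by apply/seteqP; split => x.
Qed.

End markov_transition.

Lemma same_distribution_cylinder (R : realType) d0 (T0 : measurableType d0)
    d1 (T1 : measurableType d1) (mu1 : probability T1 R)
    d2 (T2 : measurableType d2) (mu2 : probability T2 R)
    (xi1 : nat -> {RV mu1 >-> T0}) (xi2 : nat -> {RV mu2 >-> T0}) :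
  (forall n (A : nat -> set T0), (forall i, measurable (A i)) ->
    mu1 [set x | forall i, (i < n)%N -> A i (xi1 i x)] =
    mu2 [set x | forall i, (i < n)%N -> A i (xi2 i x)]) ->
  same_distribution xi1 xi2.
Proof.
move=> h A mA.
have seq_rv d (T : measurableType d) (mu : probability T R) (xi : nat -> {RV mu >-> T0}) :
    exists m : {finite_measure set (seqspace T0) -> \bar R},
      forall B, m B = mu ((fun x n => xi n x) @^-1` B).
  have mxi : measurable_fun setT (fun x => (fun n => xi n x) : seqspace T0).
    by apply: measurable_to_seqspace.
  pose X : {mfun T >-> seqspace T0} := HB.pack (fun x => (fun n => xi n x) : seqspace T0)
    (isMeasurableFun.Build _ _ _ _ _ mxi).
  by exists [the {finite_measure set _ -> \bar R} of distribution mu X].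
have [m1 m1E] := seq_rv _ _ _ xi1; have [m2 m2E] := seq_rv _ _ _ xi2.
rewrite -m1E -m2E; apply: seqspace_measure_unique => // n B mB.
by rewrite m1E m2E; exact: h.
Qed.

Theorem theorem3p3p2 (R : realType)
  (d0 : measure_display) (Omega0 : measurableType d0)
  (d : measure_display) (Omega : measurableType d) (mu : probability Omega R)
  (xi : nat -> {RV mu >-> Omega0}) (f : {mfun Omega0 >-> Omega0}) :
  standard_borel R Omega0 -> standard_borel R Omega ->
  stationary_sequence xi -> markov_sequence xi ->
  partially_spreadable (mu := mu) (fun n => f \o xi n).
Proof.
move=> /standard_borel_retract[phi [psi phiK]] _ stat markov.
pose Y n : {mfun Omega >-> cantor} := phi \o xi n.
have [g g_kernel] := exists_kernel_representation mu (Y 0%N) (Y 1%N).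
have [enc [dec [encK decK]]] := exists_nat_pairing.
have Y_markov := markov_transition stat markov phiK g_kernel.
have Y_stat A : measurable A -> mu (Y 1%N @^-1` A) = mu (Y 0%N @^-1` A).
  exact: (stationary_single stat phi 1).
pose P := [the probability _ R of dilation mu Y].
pose eta := dilation_map enc dec g.
pose fst_mfun : {mfun (cantor * cantor)%type >-> cantor} :=
  HB.pack (fst : cantor * cantor -> cantor) (isMeasurableFun.Build _ _ _ _ _ measurable_fst).
pose iter_mfun n : {mfun (cantor * cantor)%type >-> (cantor * cantor)%type} :=
  iter n (markov_shift enc dec g).
(* The state reaches [Omega0] through [psi]; only the first coordinate enters, so the maps of
   positive index leave [zeta 0] unchanged. *)
pose zeta n : {mfun (cantor * cantor)%type >-> Omega0} := f \o psi \o fst_mfun \o iter_mfun n.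
exists _, (cantor * cantor)%type, P, zeta, eta; split.
- exact: standard_borel_cantor_pair.
- apply: same_distribution_cylinder => n A mA.
  pose A' i := (f \o psi) @^-1` A i.
  have mA' i : measurable (A' i) by exact: (measurable_funPTI (f \o psi)).
  transitivity (mu (past Y A' n)).
    by congr (mu _); apply/seteqP; split => x h i /h; rewrite /A' /preimage /= phiK.
  by rewrite -(dilation_pastE encK decK Y_markov).
- split.
  + exact: (dilation_map_preserving encK decK Y_markov Y_stat).
  + by move=> k l; exact: dilation_map_comm.
  + by move=> [|k] // _.
  + by move=> n; apply/funext => z.
Qed.
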